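(* Let $W$ be an affine Weyl group with associated finite Weyl group $\mathring W$. Assume $q_1,q_2\in\mathbb{C}$ are such that $q_1,q_2\ne0$ and $q:=-\frac{q_1}{q_2}$ is not a $k$-th root of unity for any integer $1\le k\le2\,\mathrm{ht}(\theta^\vee)$. Then the level $0$ representation of the affine Hecke algebra $\mathrm{H}(W)(q_1,q_2)$ on $\mathbb{C}\mathring W$ is isomorphic to the principal series representation $M(t)$ for the character $t:Y^{\lambda^\vee}\mapsto q^{-\mathrm{ht}(\lambda^\vee)}$.
   Context: Affine Weyl group. Let $M=(a_{i,j})_{i,j\in I}$, $I=\{0,\dots,n\}$, $n\ge1$, be an indecomposable generalized Cartan matrix of affine type (twisted or untwisted) and $W=\langle s_i\mid i\in I\rangle$ its affine Weyl group. Let $\mathfrak h^*=\bigoplus_{i\in I}\mathbb{R}\alpha_i$ and let $\mathfrak h=\bigoplus_{i\in I}\mathbb{R}\Lambda_i^\vee$ be its dual, $\langle\Lambda^\vee_i,\alpha_j\rangle=\delta_{ij}$; put $\alpha_i^\vee=\sum_j a_{i,j}\Lambda_j^\vee$. $W$ acts on $\mathfrak h$ by $s_i(x)=x-\langle x,\alpha_i\rangle\alpha_i^\vee$ and on $\mathfrak h^*$ by $s_i(y)=y-\langle\alpha_i^\vee,y\rangle\alpha_i$. Let $\delta=\sum_i a_i\alpha_i$, where the $a_i$ are the positive coprime integers with $\sum_j a_{i,j}a_j=0$ for all $i$. $W$ stabilizes each $\mathfrak h^\ell=\{x\in\mathfrak h\mid\langle x,\delta\rangle=\ell\}$. $\mathring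 W$ is the (finite) image of $W$ in $GL(\mathfrak h^0)$, and $\mathrm{cl}:W\to\mathring W$ is the quotient map; nodes are labelled so that $\mathrm{cl}$ restricts to an isomorphism from $\langle s_1,\dots,s_n\rangle$ onto $\mathring W$, through which these are identified. $\mathring W$ has roots $\mathring R=\{w(\alpha_i)\mid w\in\mathring W,1\le i\le n\}$, positive roots $\mathring R^+$, simple coroots $\alpha_1^\vee,\dots,\alpha_n^\vee$ and coroot lattice $\mathring R^\vee_{\mathbb Z}=\bigoplus_{i=1}^n\mathbb{Z}\alpha_i^\vee$. The height of $\lambda^\vee=\sum_{i=1}^n\lambda_i\alpha_i^\vee$ is $\mathrm{ht}(\lambda^\vee)=\sum_i\lambda_i$; $\theta^\vee$ is the highest coroot of $\mathring W$. Alcoves. The reflections of $W$ are the maps $x\mapsto x-\langle x,\alpha-m\delta\rangle\alpha^\vee$ for $\alpha\in\mathring R^+$ and $m\in c_\alpha\mathbb{Z}$, with certain $c_\alpha\in\mathbb{Q}_{>0}$ ($c_\alpha=1$ in untwisted types); put $c(\lambda^\vee)=\sum_ic_{\alpha_i}\lambda_i\alpha_i^\vee$. $W$ contains the translation $t_{\lambda^\vee}:x\mapsto x+\langle x,\delta\rangle c(\lambda^\vee)$. Fix $\ell>0$. The fundamental alcove is $A=\{x\in\mathfrak h^\ell\mid\langle x,\alpha_i\rangle>0\ \forall i\in I\}$. An alcove walk $i_1,\dots,i_r$ from $A$ to $w(A)$ is a sequence with $w=s_{i_1}\cdots s_{i_r}$, giving alcoves $A,s_{i_1}(A),\dots,s_{i_1}\cdots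 s_{i_r}(A)$; its $k$-th step crosses a hyperplane $\{x\in\mathfrak h^\ell\mid\langle x,\alpha\rangle=\ell m\}$ with $\alpha\in\mathring R^+$, and $\epsilon_k=1$ if it goes to the side $\langle x,\alpha\rangle>\ell m$, $\epsilon_k=-1$ otherwise. Affine Hecke algebra. $\mathrm{H}(W)(q_1,q_2)$ is the $\mathbb{C}$-algebra generated by $T_i$, $i\in I$, subject to $(T_i-q_1)(T_i-q_2)=0$ and the braid relations of $W$. For $\lambda^\vee\in\mathring R^\vee_{\mathbb Z}$, $Y^{\lambda^\vee}:=(-q_1q_2)^{-\mathrm{ht}(\lambda^\vee)}T_{i_1}^{\epsilon_1}\cdots T_{i_r}^{\epsilon_r}$ for any alcove walk $i_1,\dots,i_r$ from $A$ to $t_{\lambda^\vee}(A)$ (independent of the walk). One has $Y^{\lambda^\vee}Y^{\mu^\vee}=Y^{\lambda^\vee+\mu^\vee}$; $Y$ is the group of the $Y^{\lambda^\vee}$, $\mathbb{C}[Y]$ their span (a group algebra), and $\mathrm{H}(W)(q_1,q_2)\simeq\mathrm{H}(\mathring W)(q_1,q_2)\otimes\mathbb{C}[Y]$ as vector spaces. For a character $t:Y\to\mathbb{C}^*$, $M(t)$ is the (right) $\mathrm{H}(W)(q_1,q_2)$-module induced from the one-dimensional $\mathbb{C}[Y]$-module with character $t$. Level $0$ representation. Let $\mathring\rho^\vee\in\mathfrak h^0$ be the half sum of the positive coroots of $\mathring W$. On $\mathbb{C}\mathring W$ (basis $\mathring W$), operators act on the right: $w.s_i=w\,\mathrm{cl}(s_i)$;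 $w.\pi_i=w\,\mathrm{cl}(s_i)$ if $\langle w^{-1}(\mathring\rho^\vee),\alpha_i\rangle>0$ and $w.\pi_i=w$ otherwise ($i\in I$). $T_i$ acts as $(q_1+q_2)\pi_i-q_1s_i$. *)

(* Defs.v *)
From HB Require Import structures.
From mathcomp Require Import all_boot all_order all_algebra.
From mathcomp Require Import generic_quotient ring_quotient finmap.
From mathcomp Require Import all_classical all_reals.
From mathcomp Require Import complex.
From mathcomp Require Import -(notations) monalg.

Set Implicit Arguments.
Unset Strict Implicit.
Unset Printing Implicit Defensive.

Import Order.TTheory GRing.Theory Num.Theory.

Local Open Scope ring_scope.
Local Open Scope quotient_scope.

Section Span.
Variables (K : nzRingType) (V : lmodType K) (P : V -> Prop).

Inductive in_span : V -> Prop :=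
| in_span0 : in_span 0
| in_spanD a u v of P u & in_span v : in_span (a *: u + v).

Definition span_pred : {pred V} := [pred v | `[< in_span v >]].

Lemma span_predP v : reflect (in_span v) (v \in span_pred).
Proof. exact: asboolP. Qed.

Lemma span_gen u : P u -> u \in span_pred.
Proof.
move=> Pu; apply/span_predP.
by rewrite -[u]scale1r -[_ *: u]addr0; apply: in_spanD => //; apply: in_span0.
Qed.

Fact span_submod_closed : submod_closed span_pred.
Proof.
split; first by apply/span_predP; apply: in_span0.
move=> a u v /span_predP Su /span_predP Sv; apply/span_predP.
elim: Su => [|b x y Px _ IH]; first by rewrite scaler0 add0r.
by rewrite scalerDr scalerA -addrA; apply: in_spanD.
Qed.

HB.instance Definition _ :=
  GRing.isSubmodClosed.Build K V span_pred span_submod_closed.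


Definition span_quot := Quotient.quot span_pred.

HB.instance Definition _ := GRing.Zmodule.on span_quot.
HB.instance Definition _ := EqQuotient.on span_quot.

Definition span_pi : V -> span_quot := \pi_span_quot.

Lemma span_piP u v : reflect (span_pi u = span_pi v) (u - v \in span_pred).
Proof. by rewrite Quotient.idealrBE; apply: eqP. Qed.

Lemma span_reprK x : span_pi (repr x) = x.
Proof. exact: reprK. Qed.

Fact span_pi_is_zmod_morphism : zmod_morphism span_pi.
Proof. by move=> u v; rewrite /span_pi !piE. Qed.

HB.instance Definition _ :=
  GRing.isZmodMorphism.Build V span_quot span_pi span_pi_is_zmod_morphism.

Definition span_quot_scale (a : K) (x : span_quot) : span_quot :=
  span_pi (a *: repr x).

Lemma span_pi_scale a u : span_pi (a *: u) = span_quot_scale a (span_pi u).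
Proof.
apply/span_piP; rewrite -scalerBr rpredZ //; apply/span_piP.
by rewrite span_reprK.
Qed.

Fact span_quot_scaleA a b x :
  span_quot_scale a (span_quot_scale b x) = span_quot_scale (a * b) x.
Proof. by rewrite -[x]span_reprK -!span_pi_scale scalerA. Qed.

Fact span_quot_scale1 : left_id 1 span_quot_scale.
Proof. by move=> x; rewrite -[x]span_reprK -!span_pi_scale scale1r. Qed.

Fact span_quot_scaleDr : right_distributive span_quot_scale +%R.
Proof.
move=> a x y; rewrite -[x]span_reprK -[y]span_reprK.
by rewrite -raddfD -!span_pi_scale scalerDr raddfD.
Qed.

Fact span_quot_scaleDl x : {morph span_quot_scale^~ x : a b / a + b}.
Proof.
by move=> a b; rewrite -[x]span_reprK -!span_pi_scale scalerDl raddfD.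
Qed.

HB.instance Definition _ := GRing.Zmodule_isLmodule.Build K span_quot
  span_quot_scaleA span_quot_scale1 span_quot_scaleDr span_quot_scaleDl.

HB.instance Definition _ := GRing.isScalable.Build K V span_quot *:%R span_pi
  span_pi_scale.

End Span.

Section PresentedAlgebra.
Variables (C : comNzRingType) (I : choiceType).

Definition free_alg := malg (fmonom I) C.
HB.instance Definition _ := GRing.Lalgebra.on free_alg.

Definition free_gen (i : I) : free_alg := mkmalgU (fmu i) 1.

Lemma free_scalerAr a (x y : free_alg) : a *: (x * y) = x * (a *: y).
Proof.
have cC (z : free_alg) : z * malgC a = a *: z.
  rewrite malgZ_def malgM_def fgmulgU; apply: eq_bigr => k _.
  by rewrite mulm1 mulrC.
by rewrite -[in RHS]cC mulrA cC.
Qed.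

Variable rel : free_alg -> Prop.

Definition ideal_gen (z : free_alg) : Prop :=
  exists x r y, rel r /\ z = x * r * y.

Definition presented := span_quot ideal_gen.

HB.instance Definition _ := GRing.Lmodule.on presented.
HB.instance Definition _ := EqQuotient.on presented.

Definition presented_pi : {linear free_alg -> presented} :=
  @span_pi C free_alg ideal_gen.

Lemma ideal_mull x u :
  u \in span_pred ideal_gen -> x * u \in span_pred ideal_gen.
Proof.
move=> /span_predP; elim=> [|a v w [y [r [z [Rr ->]]]] _ IH].
  by rewrite mulr0 rpred0.
rewrite mulrDr -free_scalerAr; apply: rpredD => //.
apply: rpredZ; apply: span_gen.
exists (x * y), r, z; split; first exact: Rr.
by rewrite (mulrA x (y * r)) (mulrA x y).
Qed.

Lemma ideal_mulr x u :
  u \in span_pred ideal_gen -> u * x \in span_pred ideal_gen.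
Proof.
move=> /span_predP; elim=> [|a v w [y [r [z [Rr ->]]]] _ IH].
  by rewrite mul0r rpred0.
rewrite mulrDl -scalerAl; apply: rpredD => //.
apply: rpredZ; apply: span_gen.
exists y, r, (z * x); split; first exact: Rr.
exact: (esym (mulrA _ _ _)).
Qed.

Fact presented_key : unit. Proof. by []. Qed.

Definition presented_mul : presented -> presented -> presented :=
  locked_with presented_key (fun x y => presented_pi (repr x * repr y)).

Lemma presented_piM u v :
  presented_pi (u * v) = presented_mul (presented_pi u) (presented_pi v).
Proof.
have Jr w : w - repr (presented_pi w) \in span_pred ideal_gen.
  by apply/span_piP; rewrite span_reprK.
rewrite /presented_mul unlock; apply/span_piP.
have -> : u * v - repr (presented_pi u) * repr (presented_pi v) =
   u * (v - repr (presented_pi v)) +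
   (u - repr (presented_pi u)) * repr (presented_pi v).
  by rewrite mulrBr mulrBl addrA subrK.
by apply: rpredD; [apply: ideal_mull | apply: ideal_mulr].
Qed.

Let reprK' (x : presented) : presented_pi (repr x) = x.
Proof. exact: span_reprK. Qed.

Fact presented_mulA : associative presented_mul.
Proof.
move=> x y z; rewrite -[x]reprK' -[y]reprK' -[z]reprK'.
by rewrite -!presented_piM mulrA.
Qed.

Fact presented_mul1r : left_id (presented_pi 1) presented_mul.
Proof. by move=> x; rewrite -[x]reprK' -!presented_piM mul1r. Qed.

Fact presented_mulr1 : right_id (presented_pi 1) presented_mul.
Proof. by move=> x; rewrite -[x]reprK' -!presented_piM mulr1. Qed.

Fact presented_mulDl : left_distributive presented_mul +%R.
Proof.
move=> x y z; rewrite -[x]reprK' -[y]reprK' -[z]reprK'.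
by rewrite -linearD -!presented_piM mulrDl linearD.
Qed.

Fact presented_mulDr : right_distributive presented_mul +%R.
Proof.
move=> x y z; rewrite -[x]reprK' -[y]reprK' -[z]reprK'.
by rewrite -linearD -!presented_piM mulrDr linearD.
Qed.

(* The quotient might be trivial, hence PzRing rather than NzRing. *)
HB.instance Definition _ := GRing.Zmodule_isPzRing.Build presented
  presented_mulA presented_mul1r presented_mulr1
  presented_mulDl presented_mulDr.

Lemma presented_piMr u v :
  presented_pi u * presented_pi v = presented_pi (u * v).
Proof. by rewrite presented_piM. Qed.

Lemma presented_pi1 : presented_pi 1 = 1.
Proof. by []. Qed.

Lemma presented_scalerAl a (x y : presented) : a *: (x * y) = (a *: x) * y.
Proof.
rewrite -[x]reprK' -[y]reprK'.
by rewrite presented_piMr -!linearZ presented_piMr scalerAl.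
Qed.

Lemma presented_scalerAr a (x y : presented) : a *: (x * y) = x * (a *: y).
Proof.
rewrite -[x]reprK' -[y]reprK'.
by rewrite presented_piMr -!linearZ presented_piMr free_scalerAr.
Qed.

Lemma rel_ideal r : rel r -> r \in span_pred ideal_gen.
Proof.
move=> Rr; apply: span_gen; exists 1, r, 1; split; first exact: Rr.
by rewrite mul1r mulr1.
Qed.

Lemma presented_rel r : rel r -> presented_pi r = 0.
Proof.
move=> /rel_ideal Jr; rewrite -[RHS](linear0 presented_pi); apply/span_piP.
by rewrite subr0.
Qed.

End PresentedAlgebra.

Lemma quadratic_expand (C : comNzRingType) (A : lalgType C)
    (sAr : forall (a : C) (u v : A), a *: (u * v) = u * (a *: v))
    (q1 q2 : C) (x : A) :
  (x - q1 *: 1) * (x - q2 *: 1) =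
    - ((q1 + q2) *: x - x * x - (q1 * q2) *: 1).
Proof.
rewrite mulrBl !mulrBr -!scalerAl -!sAr !mulr1 !mul1r scalerA scalerDl.
by rewrite !opprB opprD addrCA addrA addrA addrAC -!addrA.
Qed.

Section Hecke.
Variables (C : fieldType) (I : choiceType).
(* [coxeter_order i j m]: the product of the distinct generators [i] and [j] of
   the Coxeter group has finite order [m]. *)
Variables (coxeter_order : I -> I -> nat -> Prop) (q1 q2 : C).

Local Notation x := (@free_gen C I).

Definition alternating (i j : I) (m : nat) : free_alg C I :=
  \prod_(k < m) x (if odd k then j else i).

Inductive hecke_rel : free_alg C I -> Prop :=
| hecke_quadratic i : hecke_rel ((x i - q1 *: 1) * (x i - q2 *: 1))
| hecke_braid i j m of coxeter_order i j m :
    hecke_rel (alternating i j m - alternating j i m).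

Local Notation hecke := (presented hecke_rel).

Definition hecke_T (i : I) : hecke := presented_pi hecke_rel (x i).

(* The inverse of [hecke_T i], see [hecke_TK]. *)
Definition hecke_Tinv (i : I) : hecke :=
  (q1 * q2)^-1 *: ((q1 + q2) *: (1 : hecke) - hecke_T i).

Lemma hecke_TK i : q1 != 0 -> q2 != 0 ->
  hecke_T i * hecke_Tinv i = 1 /\ hecke_Tinv i * hecke_T i = 1.
Proof.
move=> q1_neq0 q2_neq0; have q12 : q1 * q2 != 0 by rewrite mulf_neq0.
pose xinv := (q1 * q2)^-1 *: ((q1 + q2) *: 1 - x i).
have TinvE : hecke_Tinv i = presented_pi hecke_rel xinv.
  by rewrite /xinv linearZ linearB linearZ.
have sAr a (u v : free_alg C I) := free_scalerAr a u v.
have quadE := quadratic_expand sAr q1 q2 (x i).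
have XK : (q1 + q2) *: x i - x i * x i - (q1 * q2) *: 1
    \in span_pred (ideal_gen hecke_rel).
  rewrite -[X in X \in _]opprK -quadE rpredN.
  exact/rel_ideal/hecke_quadratic.
have invE := rpredZ (q1 * q2)^-1 XK.
rewrite scalerBr scalerA (mulVf q12) scale1r in invE.
rewrite TinvE /hecke_T !presented_piMr -presented_pi1.
split; apply/span_piP; rewrite /xinv.
  by rewrite -free_scalerAr mulrBr -free_scalerAr mulr1.
by rewrite -scalerAl mulrBl -scalerAl mul1r.
Qed.

(* [C_chi (x)_(C[Y]) H] for the one-dimensional module [C_chi] with basis [1]:
   since [C (x)_C H = H], this is [H] modulo the balancing relations
   [1.Y_l (x) h = 1 (x) Y_l h], the [Y_l] spanning [C[Y]]. *)
Variables (L : Type) (Y : L -> hecke) (chi : L -> C).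

Definition balancing (z : hecke) : Prop :=
  exists l h, z = Y l * h - chi l *: h.

Definition induced := span_quot balancing.

HB.instance Definition _ := GRing.Lmodule.on induced.

Definition induced_pi : {linear hecke -> induced} := span_pi balancing.

Definition induced_act (x : induced) (h : hecke) : induced :=
  induced_pi (repr x * h).

Lemma induced_actE u h : induced_act (induced_pi u) h = induced_pi (u * h).
Proof.
apply/span_piP; rewrite -mulrBl.
have: repr (induced_pi u) - u \in span_pred balancing.
  by apply/span_piP; rewrite span_reprK.
move/span_predP; elim=> [|a v w [l [g ->]] _ IH].
  by rewrite mul0r rpred0.
rewrite mulrDl -presented_scalerAl; apply: rpredD => //.
apply: rpredZ; apply: span_gen.
by exists l, (g * h); rewrite mulrBl -presented_scalerAl mulrA.
Qed.

End Hecke.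

Section AffineCartan.
Variables (R : realType) (n : nat).

Implicit Types M : 'M[int]_n.+1.

Definition gen_cartan_matrix M : Prop :=
  [/\ forall i, M i i = 2,
      forall i j, i != j -> M i j <= 0 &
      forall i j, M i j = 0 -> M j i = 0].

Definition indecomposable M : Prop :=
  forall J : {set 'I_n.+1}, J != finset.set0 -> J != [set: 'I_n.+1]%SET ->
  exists i j, [/\ i \in J, j \notin J & M i j != 0].

(* Trichotomy of generalized Cartan matrices, Kac, Infinite dimensional Lie
   algebras, Theorem 4.3 (Aff). *)
Definition affine_type M : Prop :=
  let B : 'M[R]_n.+1 := map_mx intr M in
  [/\ \rank B = n,
      exists u : 'cV[R]_n.+1, (forall i, 0 < u i 0) /\ B *m u = 0 &
      forall v : 'cV[R]_n.+1, (forall i, 0 <= (B *m v) i 0) -> B *m v = 0].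

Record affine_cartan := AffineCartan {
  cartan :> 'M[int]_n.+1;
  cartanP : gen_cartan_matrix cartan;
  cartan_indecomposable : indecomposable cartan;
  cartan_affine : affine_type cartan;
  mark : 'I_n.+1 -> nat;
  mark_gt0 : forall i, (0 < mark i)%N;
  mark_coprime : (\big[gcdn/0]_i mark i)%N = 1%N;
  mark_null : forall i, \sum_j cartan i j * (mark j)%:Z = 0
}.

End AffineCartan.

Section AffineWeyl.
Variables (R : realType) (n : nat) (A : affine_cartan R n).

Local Notation I := 'I_n.+1.

(* Coordinates of [h] on the fundamental coweights, of the dual of [h] on the
   simple roots. *)
Local Notation h := 'rV[R]_n.+1.
Local Notation hdual := 'rV[R]_n.+1.

Definition pairing (x : h) (y : hdual) : R := \sum_i x 0 i * y 0 i.

Definition sroot (i : I) : hdual := delta_mx 0 i.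
Definition scoroot (i : I) : h := \row_j (A i j)%:~R.
Definition delta : hdual := \row_i (mark A i)%:R.

Definition srefl (i : I) (x : h) : h := x - pairing x (sroot i) *: scoroot i.
Definition srefl_dual (i : I) (y : hdual) : hdual :=
  y - pairing (scoroot i) y *: sroot i.

(* Elements of [W] are given by words in the simple reflections, and compared
   through their (faithful) action on [h]. *)
Definition waction (s : seq I) (x : h) : h := foldr srefl x s.
Definition waction_dual (s : seq I) (y : hdual) : hdual := foldr srefl_dual y s.

Definition coxeter_order (i j : I) (m : nat) : Prop :=
  let r := waction [:: i; j] in
  [/\ i != j, (0 < m)%N, iter m r =1 id &
      forall k, (0 < k < m)%N -> ~ (iter k r =1 id)].

Definition fnode (i : 'I_n) : I := lift ord0 i.

Definition dual_form (y : hdual) (x : h) : R^o := pairing x y.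

Fact dual_form_is_linear y : linear (dual_form y).
Proof.
move=> a u v; rewrite /dual_form /pairing scaler_sumr -big_split /=.
by apply: eq_bigr => i _; rewrite !mxE mulrDl scalerAl.
Qed.

HB.instance Definition _ y := GRing.isLinear.Build R h R^o *:%R (dual_form y)
  (dual_form_is_linear y).

Lemma pairingP a u v y : pairing (a *: u + v) y = a * pairing u y + pairing v y.
Proof. exact: (linearP (dual_form y)). Qed.

Lemma pairing_delta i : pairing (scoroot i) delta = 0.
Proof.
have := mark_null A i => /(congr1 (intr : int -> R)).
rewrite rmorph_sum rmorph0 /= => <-; apply: eq_bigr => j _.
by rewrite !mxE rmorphM.
Qed.

Definition h0 : {vspace h} := lker (linfun (dual_form delta)).

Lemma mem_h0 x : (x \in h0) = (pairing x delta == 0).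
Proof. by rewrite memv_ker lfunE. Qed.

Fact srefl_is_linear i : linear (srefl i).
Proof.
move=> a u v; rewrite /srefl pairingP scalerDl scalerBr scalerA opprD.
by rewrite addrACA.
Qed.

HB.instance Definition _ i := GRing.isLinear.Build R h h *:%R (srefl i)
  (srefl_is_linear i).

Fact waction_is_linear s : linear (waction s).
Proof. by elim: s => [|i s IH] a u v //=; rewrite IH linearP. Qed.

HB.instance Definition _ s := GRing.isLinear.Build R h h *:%R (waction s)
  (waction_is_linear s).

Lemma srefl_delta i x : pairing (srefl i x) delta = pairing x delta.
Proof. by rewrite /srefl addrC -scaleNr pairingP pairing_delta mulr0 add0r. Qed.

Lemma waction_delta s x : pairing (waction s x) delta = pairing x delta.
Proof. by elim: s => //= i s IH; rewrite srefl_delta. Qed.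

Lemma waction_cat s1 s2 x : waction (s1 ++ s2) x = waction s1 (waction s2 x).
Proof. by rewrite /waction foldr_cat. Qed.

Definition cl (s : seq I) : 'End(subvs_of h0) :=
  linfun (vsproj h0 \o waction s \o vsval).

Lemma clE s x : vsval (cl s x) = waction s (vsval x).
Proof.
rewrite lfunE /= vsprojK // mem_h0 waction_delta -mem_h0; exact: subvsP.
Qed.

Lemma cl_cat s1 s2 : cl (s1 ++ s2) = (cl s1 \o cl s2)%VF.
Proof.
apply/lfunP => x; apply: val_inj.
by rewrite comp_lfunE -[LHS]/(vsval _) -[RHS]/(vsval _) !clE waction_cat.
Qed.

Definition in_W0 (g : 'End(subvs_of h0)) : bool := `[< exists s, g = cl s >].

Definition W0 := {g : 'End(subvs_of h0) | in_W0 g}.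

HB.instance Definition _ := SubChoice.on W0.

Fact W0_mulP (w : W0) i : in_W0 (val w \o cl [:: i])%VF.
Proof.
case: w => g /= /asboolP[s ->]; apply/asboolP; exists (s ++ [:: i]).
by rewrite cl_cat.
Qed.

(* The product w cl(s_i) in [GL(h0)]. *)
Definition W0_mul (w : W0) (i : I) : W0 := Sub _ (W0_mulP w i).

(* [cl] restricts to an isomorphism from <s_1, ..., s_n> onto [W0] *)
Definition special_labelling : Prop :=
  (forall s s' : seq 'I_n, cl (map fnode s) = cl (map fnode s') ->
     waction (map fnode s) =1 waction (map fnode s')) /\
  (forall s : seq I, exists s' : seq 'I_n, cl s = cl (map fnode s')).

(* Pairs (a, a^vee) of a root of [W0] and its coroot. *)
Definition froot (a : hdual) (av : h) : Prop :=
  exists (s : seq 'I_n) (i : 'I_n),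
    a = waction_dual (map fnode s) (sroot (fnode i)) /\
    av = waction (map fnode s) (scoroot (fnode i)).

Definition pos_froot (a : hdual) (av : h) : Prop :=
  froot a av /\ forall i, 0 <= a 0 i.

Definition pos_coroots : set h := [set av | exists a, pos_froot a av]%classic.

(* The sum is over a finite set, so that it is not the default value of
   [fsbigop]. *)
Definition rho : subvs_of h0 :=
  vsproj h0 (2^-1 *: \sum_(av \in pos_coroots) av).

Implicit Types la : 'rV[int]_n.

Definition height la : int := \sum_i la 0 i.

Definition coroot_vec la : h := \sum_i (la 0 i)%:~R *: scoroot (fnode i).

Definition highest_coroot la : Prop :=
  (exists a, froot a (coroot_vec la)) /\
  (forall mu a, froot a (coroot_vec mu) -> forall i, mu 0 i <= la 0 i).

Definition affine_refl (a : hdual) (av : h) (m : R) (x : h) : h :=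
  x - pairing x (a - m *: delta) *: av.

Definition is_reflection (f : h -> h) : Prop :=
  exists s i, f =1 waction (s ++ i :: rev s).

(* [c a] is the positive rational such that the reflections of [W] are the
   [x |-> x - <x, a - m delta> a^vee], [a] a positive root of [W0] and [m] in
   [c a * Z]. *)
Definition reflection_spacing (c : hdual -> rat) : Prop :=
  (forall a av, pos_froot a av -> 0 < c a) /\
  (forall f, is_reflection f <->
     exists a av (k : int),
       pos_froot a av /\ f =1 affine_refl a av (k%:~R * ratr (c a))).

Variable c : hdual -> rat.

Definition translation la (x : h) : h :=
  x + pairing x delta *:
    \sum_i (ratr (c (sroot (fnode i))) * (la 0 i)%:~R) *: scoroot (fnode i).

Variable l : R.

Definition fund_alcove : set h :=
  [set x | pairing x delta = l /\ forall i, 0 < pairing x (sroot i)]%classic.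

Definition alcove (s : seq I) : set h := (waction s @` fund_alcove)%classic.

(* The step from [alcove s] to [alcove (rcons s i)] crosses a hyperplane
   <x, a> = l m, [a] a positive root of [W0], to the side <x, a> > l m. *)
Definition positive_step (s : seq I) (i : I) : Prop :=
  exists a av (k : int), let m := k%:~R * ratr (c a) in
  [/\ pos_froot a av,
      forall x, alcove s x -> pairing x a < l * m &
      forall x, alcove (rcons s i) x -> l * m < pairing x a].

Variables q1 q2 : R[i].

Local Notation H := (presented (hecke_rel coxeter_order q1 q2)).

(* [pre] is the part of the walk already performed. *)
Fixpoint walk_T (pre s : seq I) : H :=
  if s is i :: s' then
    (if `[< positive_step pre i >] then hecke_T coxeter_order q1 q2 i
     else hecke_Tinv coxeter_order q1 q2 i) * walk_T (rcons pre i) s'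
  else 1.

Definition translation_walk la : set (seq I) :=
  [set s | waction s =1 translation la]%classic.

(* A walk exists since the translation lies in [W], and the value does not
   depend on the walk chosen. *)
Definition Y la : H :=
  (- (q1 * q2)) ^ (- height la) *:
    walk_T [::] (xget [::] (translation_walk la)).

Definition principal_series (chi : 'rV[int]_n -> R[i]) := induced Y chi.

HB.instance Definition _ chi := GRing.Lmodule.on (principal_series chi).

(* x.T_i, for the right action of [H] *)
Definition principal_series_T chi (i : I) (x : principal_series chi) :
    principal_series chi :=
  induced_act x (hecke_T coxeter_order q1 q2 i).

Definition CW0 := malg W0 R[i].

HB.instance Definition _ := GRing.Lmodule.on CW0.

Definition lin_ext (f : W0 -> W0) (v : CW0) : CW0 :=
  \sum_(w <- msupp v) mcoeff w v *: mkmalgU (f w) 1.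

Definition level0_s (i : I) : CW0 -> CW0 := lin_ext (W0_mul ^~ i).

Definition level0_pi (i : I) : CW0 -> CW0 :=
  lin_ext (fun w =>
    if 0 < pairing (vsval ((val w)^-1%VF rho)) (sroot i) then W0_mul w i
    else w).

Definition level0_T (i : I) (v : CW0) : CW0 :=
  (q1 + q2) *: level0_pi i v - q1 *: level0_s i v.

End AffineWeyl.

(* Main.v *)
Require Import Defs.
From HB Require Import structures.
From mathcomp Require Import all_boot all_order all_algebra.
From mathcomp Require Import finmap.
From mathcomp Require Import all_classical all_reals.
From mathcomp Require Import complex.
From mathcomp Require Import zify ring lra.
From mathcomp Require Import -(notations) monalg.

(** Let [w] be the element of the finite Weyl group such that [w^-1 rho] is
    antidominant.  Along an alcove walk started at [w], a positive step acts by
    [w'.T_i = q2 w'.s_i] and a negative one by [w'.T_i^-1 = q2^-1 w'.s_i], so that a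
    walk acts on [w] through a power of [q2], whose exponent is the signed number of
    hyperplanes it crosses.  For a walk to [t_la(A)] this number is [2 ht(la)], hence
    [w] is an eigenvector of [Y^la] for [(- q1 q2)^(- ht la) q2^(2 ht la) = q^(- ht la)]
    and there is a morphism from [M(t)] to [C[W0]] mapping [1 (x) 1] to [w].

    Its inverse maps [w cl(s)] to the class of the product of the [T_i^(+-1)] along the
    walk [s], rescaled by a power of [q2].  This is well defined because that product
    depends only on the end of the walk: two words with the same action on [h] are
    related by braid relations and cancellations (the affine Weyl group is a Coxeter
    group), and the signed version of a braid relation at an alcove is a conjugate of
    the one at the alcove of the dihedral coset from which all steps are positive.  The
    same dihedral argument shows that the level 0 operators satisfy the braid relations,
    and the number of crossed hyperplanes is also a function of the end of the walk, which
    reduces its computation to the translations by simple coroots.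

    Finiteness of the root system of [W0] comes from the existence of a highest
    coroot. *)

Set Implicit Arguments.
Unset Strict Implicit.
Unset Printing Implicit Defensive.

Import Order.TTheory GRing.Theory Num.Theory.

Local Open Scope ring_scope.

(* [fingraph] also declares a notation [froot]. *)
Local Notation froot := Defs.froot.

(** * Reflections *)

(** [H] is a quotient of a free algebra for which no basis is established, and [M(t)] has no known
    dimension, so bijectivity is obtained from two explicit maps inverse to each other. The sign of
    a step is defined by an affine hyperplane, but rho has level 0, where [delta] vanishes: the sign
    depends only on the value of rho on the crossed root, and a walk is signed by following the
    moving point [u^-1 rho]. Signed walks take values in an arbitrary monoid, so that one
    independence statement serves both the products of the [T_i^(+-1)] in [H] and the signed count
    of hyperplanes in the integers. For a simple coroot, the same walk is counted from rho and from
    [s_i rho]: the signs differ only at hyperplanes parallel to that of alpha_i, where a floor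
    function counts them, while conjugation by [s_i] makes the two counts opposite. The base vector
    is antidominant because [T_i] is monomial on [w] only when [<w^-1 rho, alpha_i> > 0], and these
    have to be the positive steps. The character then comes from [- q1 q2 = q q2^2]. *)

Section Reflections.
Variables (R : realType) (n : nat) (A : affine_cartan R n).
Local Notation I := 'I_n.+1.
Local Notation h := 'rV[R]_n.+1.
Implicit Types (x y : h) (i j : I) (s : seq I).

Lemma pairingC x y : pairing x y = pairing y x.
Proof. by apply: eq_bigr => i _; rewrite mulrC. Qed.

Lemma pairing_sroot x i : pairing x (sroot R i) = x 0 i.
Proof.
rewrite /pairing (bigD1 i) //= big1 => [|j /negPf ji].
  by rewrite !mxE !eqxx mulr1 addr0.
by rewrite !mxE ji mulr0.
Qed.

Lemma sroot_pairing x i : pairing (sroot R i) x = x 0 i.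
Proof. by rewrite pairingC pairing_sroot. Qed.

Lemma pairingDl x y z : pairing (x + y) z = pairing x z + pairing y z.
Proof. by have := pairingP 1 x y z; rewrite scale1r mul1r. Qed.

Lemma pairingZl a x z : pairing (a *: x) z = a * pairing x z.
Proof.
have p0 : pairing 0 z = 0 by apply: big1 => i _; rewrite mxE mul0r.
by have := pairingP a x 0 z; rewrite p0 !addr0.
Qed.

Lemma pairingDr x y z : pairing z (x + y) = pairing z x + pairing z y.
Proof. by rewrite !(pairingC z) pairingDl. Qed.

Lemma pairingZr a x z : pairing z (a *: x) = a * pairing z x.
Proof. by rewrite !(pairingC z) pairingZl. Qed.

Lemma pairingNl x z : pairing (- x) z = - pairing x z.
Proof. by rewrite -scaleN1r pairingZl mulN1r. Qed.

Lemma pairingNr x z : pairing z (- x) = - pairing z x.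
Proof. by rewrite !(pairingC z) pairingNl. Qed.

Lemma pairingBl x y z : pairing (x - y) z = pairing x z - pairing y z.
Proof. by rewrite pairingDl pairingNl. Qed.

Lemma pairingBr x y z : pairing z (x - y) = pairing z x - pairing z y.
Proof. by rewrite pairingDr pairingNr. Qed.

Lemma pairing_inj x y : (forall z, pairing z x = pairing z y) -> x = y.
Proof.
by move=> e; apply/rowP => i; rewrite -!sroot_pairing.
Qed.

Lemma srefl_dual_is_linear i : linear (srefl_dual A i).
Proof.
move=> a u v; rewrite /srefl_dual pairingDr pairingZr.
by rewrite scalerDl scalerBr scalerA opprD addrACA.
Qed.

HB.instance Definition _ i := GRing.isLinear.Build R h h *:%R (srefl_dual A i)
  (srefl_dual_is_linear i).

Lemma waction_dual_is_linear s : linear (waction_dual A s).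
Proof. by elim: s => [|i s IH] a u v //=; rewrite IH linearP. Qed.

HB.instance Definition _ s := GRing.isLinear.Build R h h *:%R (waction_dual A s)
  (waction_dual_is_linear s).

Lemma waction_dual_cat s1 s2 y :
  waction_dual A (s1 ++ s2) y = waction_dual A s1 (waction_dual A s2 y).
Proof. by rewrite /waction_dual foldr_cat. Qed.

Lemma waction_rcons s i x :
  waction A (rcons s i) x = waction A s (srefl A i x).
Proof. by rewrite -cats1 waction_cat. Qed.

Lemma waction_dual_rcons s i x :
  waction_dual A (rcons s i) x = waction_dual A s (srefl_dual A i x).
Proof. by rewrite -cats1 waction_dual_cat. Qed.

Lemma pairing_scoroot i j : pairing (scoroot A i) (sroot R j) = (A i j)%:~R.
Proof. by rewrite pairing_sroot mxE. Qed.

Lemma cartan_diag i : A i i = 2.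
Proof. by case: (cartanP A). Qed.

Lemma scoroot_diag i : scoroot A i 0 i = 2.
Proof. by rewrite mxE cartan_diag. Qed.

Lemma sreflE i x : srefl A i x = x - x 0 i *: scoroot A i.
Proof. by rewrite /srefl pairing_sroot. Qed.

Lemma pairing_srefl i x y :
  pairing (srefl A i x) y = pairing x (srefl_dual A i y).
Proof.
by rewrite /srefl /srefl_dual pairingBl pairingBr pairingZl pairingZr mulrC.
Qed.

Lemma sreflK i : involutive (srefl A i).
Proof.
move=> x; rewrite !sreflE !mxE cartan_diag -addrA -opprD -scalerDl.
by rewrite mulr_natr mulr2n opprD addNKr subrr scale0r subr0.
Qed.

Lemma srefl_dualK i : involutive (srefl_dual A i).
Proof. by move=> y; apply: pairing_inj => x; rewrite -!pairing_srefl sreflK. Qed.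

Lemma srefl_coord i x : srefl A i x 0 i = - x 0 i.
Proof.
by rewrite sreflE !mxE cartan_diag mulr_natr mulr2n opprD addNKr.
Qed.

Lemma srefl_scoroot i : srefl A i (scoroot A i) = - scoroot A i.
Proof.
by rewrite sreflE scoroot_diag scaler_nat mulr2n opprD addNKr.
Qed.

Lemma srefl_dual_sroot i j :
  srefl_dual A i (sroot R j) = sroot R j - (A i j)%:~R *: sroot R i.
Proof. by rewrite /srefl_dual pairing_scoroot. Qed.

Lemma srefl_dual_sroot_diag i : srefl_dual A i (sroot R i) = - sroot R i.
Proof.
by rewrite srefl_dual_sroot cartan_diag scaler_nat mulr2n opprD addNKr.
Qed.

Lemma srefl_dual_coord i j y : j != i -> srefl_dual A i y 0 j = y 0 j.
Proof. by move=> /negPf ji; rewrite !mxE ji andbF mulr0 subr0. Qed.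

Lemma pairing_waction s x y :
  pairing (waction A s x) y = pairing x (waction_dual A (rev s) y).
Proof.
elim: s x y => //= i s IH x y.
by rewrite pairing_srefl IH rev_cons waction_dual_rcons.
Qed.

Lemma wactionK s : cancel (waction A s) (waction A (rev s)).
Proof.
elim: s => //= i s IH x.
by rewrite rev_cons waction_rcons sreflK IH.
Qed.

Lemma wactionVK s : cancel (waction A (rev s)) (waction A s).
Proof. by move=> x; rewrite -{1}[s]revK wactionK. Qed.

Lemma waction_dualK s : cancel (waction_dual A s) (waction_dual A (rev s)).
Proof.
elim: s => //= i s IH x.
by rewrite rev_cons waction_dual_rcons srefl_dualK IH.
Qed.

Lemma waction_dualVK s : cancel (waction_dual A (rev s)) (waction_dual A s).
Proof. by move=> x; rewrite -{1}[s]revK waction_dualK. Qed.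

Lemma pairing_waction2 s x y :
  pairing (waction A s x) (waction_dual A s y) = pairing x y.
Proof. by rewrite pairing_waction waction_dualK. Qed.

Lemma pairing_waction_dual s x y :
  pairing x (waction_dual A s y) = pairing (waction A (rev s) x) y.
Proof. by rewrite pairing_waction revK. Qed.

Lemma eq_waction_rev s s' :
  waction A s =1 waction A s' -> waction A (rev s) =1 waction A (rev s').
Proof.
by move=> e x; apply: (can_inj (wactionK s)); rewrite wactionVK e wactionVK.
Qed.

Lemma eq_waction_dual s s' :
  waction A s =1 waction A s' -> waction_dual A s =1 waction_dual A s'.
Proof.
move=> /eq_waction_rev e y; apply: pairing_inj => x.
by rewrite !pairing_waction_dual e.
Qed.

Lemma waction_reflection s i x :
  waction A (s ++ i :: rev s) x =
    x - pairing x (waction_dual A s (sroot R i)) *: waction A s (scoroot A i).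
Proof.
rewrite waction_cat /= /srefl linearB linearZ /= wactionVK.
by rewrite -pairing_waction_dual.
Qed.

Definition nneg (y : h) : Prop := forall k, 0 <= y 0 k.

Definition nnegN y : nneg y -> nneg (- y) -> y = 0.
Proof.
move=> y0 Ny0; apply/rowP => k; apply/eqP; rewrite mxE eq_le y0 andbT.
by have := Ny0 k; rewrite mxE oppr_ge0.
Qed.

Lemma sroot_neq0 i : sroot R i != 0 :> h.
Proof.
by apply/eqP => /rowP/(_ i); rewrite !mxE !eqxx => /eqP; rewrite oner_eq0.
Qed.

Lemma root_neq0 s i : waction_dual A s (sroot R i) != 0.
Proof.
apply: contra_neq (sroot_neq0 i) => e.
by rewrite -[sroot _ i](waction_dualK s) e linear0.
Qed.

Lemma sroot_nneg i : nneg (sroot R i).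
Proof. by move=> k; rewrite mxE; case: andb. Qed.

End Reflections.

(** * Rank two *)

Section Alternating.
Variable (I : Type).
Implicit Types (i j : I) (m t : nat).

Fixpoint alt i j t : seq I := if t is t'.+1 then i :: alt j i t' else [::].

Definition nxt i j t : I := if odd t then j else i.

Lemma nxtS i j t : nxt i j t.+1 = nxt j i t.
Proof. by rewrite /nxt /=; case: odd. Qed.

Lemma alt_rcons i j t : alt i j t.+1 = rcons (alt i j t) (nxt i j t).
Proof.
elim: t i j => // t IH i j.
by rewrite nxtS -[LHS]/(i :: alt j i t.+1) IH.
Qed.

Lemma size_alt i j t : size (alt i j t) = t.
Proof. by elim: t i j => //= t IH i j; rewrite IH. Qed.

(** Equates the quotient of the two sides of a braid relation with a power of [s_i s_j], so that
    braid relations can be handled as relators. *)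
Lemma alt_catrev i j t : alt i j t ++ rev (alt j i t) = alt i j t.*2.
Proof.
elim: t i j => // t IH i j.
rewrite doubleS [RHS]alt_rcons nxtS /nxt odd_double /= rev_cons -IH.
by rewrite rcons_cat.
Qed.

Lemma rev_alt_double i j t : rev (alt i j t.*2) = alt j i t.*2.
Proof. by rewrite -!alt_catrev rev_cat revK. Qed.

End Alternating.

(* Coefficients of the root [P (alpha_k)], where the word [P] alternates between
   [i] and [j], on [alpha_i] and [alpha_j]; here [a = - a_ij], [b = - a_ji]. *)
Fixpoint dihedral_coef (a b : int) (t : nat) : int * int :=
  if t is t'.+1 then
    let u := dihedral_coef b a t' in (a * u.1 - u.2, u.1)
  else (1, 0).

(** The types A1 x A1, A2, B2 and G2: values of [- a_ij], [- a_ji], and an exponent that kills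
    [s_i s_j]. *)
Definition finite_rank2 : seq (int * int * nat) :=
  [:: (0, 0, 2%N); (1, 1, 3); (1, 2, 4); (2, 1, 4); (1, 3, 6); (3, 1, 6)].

Lemma rank2_cases (a b : int) : 0 <= a -> 0 <= b -> (a = 0 <-> b = 0) ->
  (exists m, (a, b, m) \in finite_rank2) \/ 4 <= a * b.
Proof.
move=> a0 b0 ab; have [?|lt4] := lerP 4 (a * b); [by right | left].
case: (eqVneq a 0) => [az|an0].
  by exists 2%N; rewrite az (proj1 ab az).
have bn0 : b <> 0 by move=> /(proj2 ab) az; rewrite az eqxx in an0.
have a3 : a <= 3 by nia.
have b3 : b <= 3 by nia.
have [ae|[ae|ae]] : a = 1 \/ a = 2 \/ a = 3 by lia.
- have [be|[be|be]] : b = 1 \/ b = 2 \/ b = 3 by lia.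
  + by exists 3; rewrite ae be.
  + by exists 4; rewrite ae be.
  + by exists 6; rewrite ae be.
- have be : b = 1 by nia.
  by exists 4; rewrite ae be.
- have be : b = 1 by nia.
  by exists 6; rewrite ae be.
Qed.

Lemma dihedral_coef_finite (a b : int) m t :
  (a, b, m) \in finite_rank2 -> (t < m)%N ->
  0 <= (dihedral_coef a b t).1 /\ 0 <= (dihedral_coef a b t).2.
Proof.
rewrite !inE => /or4P[|||/or3P[||]] /eqP[-> -> ->];
  case: t => [|[|[|[|[|[|t]]]]]] //.
Qed.

(** The third inequality is the invariant that carries the induction: applied to the swapped pair,
    it keeps the next coefficient [a * u.1 - u.2] nonnegative, and [4 <= a * b] restores it. *)
Lemma dihedral_coef_ge4 (a b : int) t : 0 <= a -> 0 <= b -> 4 <= a * b ->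
  let u := dihedral_coef a b t in
  [/\ 0 <= u.1, 0 <= u.2 & 2 * u.2 <= b * u.1].
Proof.
elim: t a b => [|t IH] a b a0 b0 ab /=; first by split=> //; lia.
have ba : 4 <= b * a by rewrite mulrC.
have := IH b a b0 a0 ba; case: (dihedral_coef b a t) => u v /= [u0 v0 uv].
have := ler_wpM2l b0 uv; have := ler_wpM2r u0 ab.
by split=> //; nia.
Qed.

Section RankTwo.
Variables (R : realType) (n : nat) (A : affine_cartan R n).
Local Notation I := 'I_n.+1.
Local Notation h := 'rV[R]_n.+1.
Implicit Types (x y : h) (i j : I) (s : seq I).

Lemma cartan_le0 i j : i != j -> A i j <= 0.
Proof. by move=> ij; case: (cartanP A) => _ /(_ i j ij). Qed.

Lemma cartan_eq0 i j : A i j = 0 -> A j i = 0.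
Proof. by case: (cartanP A) => _ _; apply. Qed.

Definition alt_root i j t : h := waction_dual A (alt i j t) (sroot R (nxt i j t)).

Lemma alt_root0 i j : alt_root i j 0 = sroot R i.
Proof. by []. Qed.

Lemma alt_rootS i j t : alt_root i j t.+1 = srefl_dual A i (alt_root j i t).
Proof. by rewrite /alt_root nxtS. Qed.

Lemma alt_rootE i j t : let u := dihedral_coef (- A i j) (- A j i) t in
  alt_root i j t = u.1%:~R *: sroot R i + u.2%:~R *: sroot R j.
Proof.
elim: t i j => [|t IH] i j /=; first by rewrite scale1r scale0r addr0.
rewrite alt_rootS IH; case: (dihedral_coef _ _ t) => u v /=.
rewrite linearD !linearZ /= srefl_dual_sroot_diag srefl_dual_sroot.
by apply/rowP => k; rewrite !mxE; ring.
Qed.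

(** Powers of [s_i s_j] move [x] only along the two simple coroots; this is the affine recursion on
    the two coefficients subtracted. *)
Let step (a b u v : R) (z : R * R) : R * R :=
  let g := v - z.2 + a * z.1 in (u - z.1 + b * g, g).

Lemma iter_dihedral i j m x :
  let z := iter m (step (- (A i j)%:~R) (- (A j i)%:~R) (x 0 i) (x 0 j)) (0, 0) in
  iter m (waction A [:: i; j]) x = x - z.1 *: scoroot A i - z.2 *: scoroot A j.
Proof.
elim: m => [|m]; first by rewrite /= !scale0r !subr0.
rewrite !iterS => ->; case: (iter m (step _ _ _ _) _) => f g /=.
rewrite ![srefl A j _]sreflE ![srefl A i _]sreflE !mxE !cartan_diag.
apply/rowP => k; rewrite !mxE; ring.
Qed.

Lemma iter_dihedral_finite i j m :
  (- A i j, - A j i, m) \in finite_rank2 -> iter m (waction A [:: i; j]) =1 id.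
Proof.
move=> mem x; rewrite iter_dihedral -!mulrNz.
suff -> : iter m (step (- A i j)%:~R (- A j i)%:~R (x 0 i) (x 0 j)) (0, 0) = (0, 0).
  by rewrite !scale0r !subr0.
move: (x 0 i) (x 0 j) mem => u v; rewrite !inE.
by case/or4P => [|||/or3P[||]] /eqP[-> -> ->];
  rewrite /step /=; congr pair; ring.
Qed.

Lemma alt_double i j m : waction A (alt i j m.*2) =1 iter m (waction A [:: i; j]).
Proof. by elim: m => // m IH x; rewrite doubleS iterS -IH. Qed.

Lemma coxeter_order_sym i j m : coxeter_order A i j m -> coxeter_order A j i m.
Proof.
case=> ij m0 e min.
have inv k : iter k (waction A [:: i; j]) =1 id -> iter k (waction A [:: j; i]) =1 id.
  move=> ek x; rewrite -alt_double -rev_alt_double.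
  by rewrite -{1}[x]ek -alt_double wactionK.
have inv' k : iter k (waction A [:: j; i]) =1 id -> iter k (waction A [:: i; j]) =1 id.
  move=> ek x; rewrite -alt_double -rev_alt_double.
  by rewrite -{1}[x]ek -alt_double wactionK.
split; rewrite 1?eq_sym //; first exact: inv.
by move=> k km /inv'; apply: min.
Qed.

Lemma coxeter_order_neq i j m : coxeter_order A i j m -> i != j.
Proof. by case. Qed.

Lemma coxeter_order_gt0 i j m : coxeter_order A i j m -> (0 < m)%N.
Proof. by case. Qed.

Lemma coxeter_order_double i j m :
  coxeter_order A i j m -> waction A (alt i j m.*2) =1 id.
Proof. by case=> _ _ e _ x; rewrite alt_double. Qed.

Lemma waction_braid i j m :
  coxeter_order A i j m -> waction A (alt i j m) =1 waction A (alt j i m).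
Proof.
move=> /coxeter_order_double e x; rewrite -[RHS]e -alt_catrev waction_cat.
by rewrite wactionK.
Qed.

Definition nneg_comb i j (y : h) : Prop :=
  exists a b : R, [/\ 0 <= a, 0 <= b & y = a *: sroot R i + b *: sroot R j].

(** Splits on [a_ij a_ji]: at most 3 gives a finite dihedral group read off the table, at least 4
    keeps all the roots of the alternating string positive. *)
Lemma rank2_dichotomy i j : i != j ->
  (exists m, coxeter_order A i j m /\ forall t, (t < m)%N -> nneg_comb i j (alt_root i j t)) \/
  (forall t, nneg_comb i j (alt_root i j t)).
Proof.
move=> ij; have ji : j != i by rewrite eq_sym.
have a0 : 0 <= - A i j by rewrite oppr_ge0 cartan_le0.
have b0 : 0 <= - A j i by rewrite oppr_ge0 cartan_le0.
have ab : - A i j = 0 <-> - A j i = 0.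
  by split=> /eqP; rewrite oppr_eq0 => /eqP/cartan_eq0 ->; rewrite oppr0.
have comb t : 0 <= (dihedral_coef (- A i j) (- A j i) t).1 /\
    0 <= (dihedral_coef (- A i j) (- A j i) t).2 -> nneg_comb i j (alt_root i j t).
  move=> [u0 v0]; rewrite alt_rootE; do 2 eexists; split; last by [].
    by rewrite ler0z.
  by rewrite ler0z.
case: (rank2_cases a0 b0 ab) => [[m mem]|ge4]; [left | right] => [|t]; last first.
  by apply: comb; case: (dihedral_coef_ge4 t a0 b0 ge4).
have e := iter_dihedral_finite mem.
have m_gt0 : (0 < m)%N.
  by move: mem; rewrite !inE => /or4P[|||/or3P[||]] /eqP[_ _ ->].
have ex : exists k, (0 < k)%N && `[< iter k (waction A [:: i; j]) =1 id >].
  by exists m; rewrite m_gt0; apply/asboolP.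
case: (ex_minnP ex) => k /andP[k_gt0 /asboolP ek] min.
(* The exact order [k] is only bounded by the exponent of the table, which is enough to import the
   positivity of the first [k] roots. *)
have km : (k <= m)%N by apply: min; rewrite m_gt0; apply/asboolP.
exists k; split=> [|t tk].
  split=> // k' /andP[k'0 k'k] ek'.
  have : (k <= k')%N by apply: min; rewrite k'0; apply/asboolP.
  by rewrite leqNgt k'k.
by apply: comb; apply: dihedral_coef_finite mem (leq_trans tk km).
Qed.

Lemma coxeter_order_uniq i j m m' :
  coxeter_order A i j m -> coxeter_order A i j m' -> m = m'.
Proof.
move=> [_ m0 e min] [_ m'0 e' min'].
case: (ltngtP m m') => // lt; [case: (min' m) | case: (min m')] => //.
  by rewrite m0.
by rewrite m'0.
Qed.

Lemma alt_root_nneg i j m t : coxeter_order A i j m -> (t < m)%N ->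
  nneg_comb i j (alt_root i j t).
Proof.
move=> o tm; case: (rank2_dichotomy (coxeter_order_neq o)) => [[m' [o' P]]|//].
by apply: P; rewrite -(coxeter_order_uniq o o').
Qed.

Lemma alt_root_order i j m : coxeter_order A i j m ->
  alt_root i j m = - alt_root j i m.-1.
Proof.
move=> o; have := coxeter_order_gt0 o; case: m o => // m o _.
rewrite /alt_root (eq_waction_dual (waction_braid o)) nxtS alt_rcons.
by rewrite waction_dual_rcons srefl_dual_sroot_diag linearN.
Qed.

(** [s_j] negates the last positive root of the string but preserves its coordinate on alpha_i,
    which must therefore vanish. *)
Lemma alt_root_last i j m : coxeter_order A i j m ->
  exists2 a, 0 < a & alt_root i j m.-1 = a *: sroot R j.
Proof.
move=> o; have := coxeter_order_gt0 o; case: m o => // m o _ /=.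
have e : srefl_dual A j (alt_root i j m) = - alt_root i j m.
  by rewrite -alt_rootS (alt_root_order (coxeter_order_sym o)).
have [a [b [a0 b0 E]]] := alt_root_nneg o (leqnn _).
have a_eq0 : a = 0.
  move: (coxeter_order_neq o) => ij.
  have := congr1 (fun y : h => y 0 i) e; rewrite srefl_dual_coord // E !mxE !eqxx.
  by rewrite (negPf ij) /=; lra.
rewrite E a_eq0 scale0r add0r; exists b => //.
rewrite lt_neqAle b0 andbT eq_sym; apply/negP => /eqP b_eq0.
have := root_neq0 A (alt i j m) (nxt i j m).
by rewrite -/(alt_root i j m) E a_eq0 b_eq0 !scale0r addr0 eqxx.
Qed.

End RankTwo.

(** * Positivity of roots and the word problem *)

Section WordProblem.
Variables (R : realType) (n : nat) (A : affine_cartan R n).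
Local Notation I := 'I_n.+1.
Local Notation h := 'rV[R]_n.+1.
Implicit Types (x y : h) (i j : I) (s u v : seq I).

(** Equality in the abstract Coxeter group given by generators and relations; [waction_weq] shows
    that the action on [h] is faithful on it. *)
Inductive weq : seq I -> seq I -> Prop :=
| weq_refl s : weq s s
| weq_sym s s' of weq s s' : weq s' s
| weq_trans s s' s'' of weq s s' & weq s' s'' : weq s s''
| weq_cancel u v i : weq (u ++ [:: i; i] ++ v) (u ++ v)
| weq_braid u v i j m of coxeter_order A i j m :
    weq (u ++ alt i j m ++ v) (u ++ alt j i m ++ v).

Lemma weq_cat u v s s' : weq s s' -> weq (u ++ s ++ v) (u ++ s' ++ v).
Proof.
elim=> [{}s|{}s {}s' _|s1 s2 s3 _ IH1 _|u' v' i|u' v' i j m o].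
- exact: weq_refl.
- exact: weq_sym.
- exact: weq_trans.
- by have := weq_cancel (u ++ u') (v' ++ v) i; rewrite -!catA.
- by have := weq_braid (u ++ u') (v' ++ v) o; rewrite -!catA.
Qed.

Lemma weq_rcons s s' i : weq s s' -> weq (rcons s i) (rcons s' i).
Proof. by rewrite -!cats1 => /(weq_cat [::] [:: i]). Qed.

Lemma weq_rcons2 s i : weq (rcons (rcons s i) i) s.
Proof. by have := weq_cancel s [::] i; rewrite !cats0 -!cats1 -catA. Qed.

Lemma weq_waction s s' : weq s s' -> waction A s =1 waction A s'.
Proof.
elim=> // {s s'} [s s' _ e|s1 s2 s3 _ e1 _ e2|u v i|u v i j m o] x.
- by rewrite e.
- by rewrite e1 e2.
- by rewrite !waction_cat /= sreflK.
- by rewrite !waction_cat (waction_braid o).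
Qed.

Lemma weq_rev s : weq (s ++ rev s) [::].
Proof.
elim/last_ind: s => [|s i IH]; first exact: weq_refl.
apply: weq_trans IH; rewrite rev_rcons -cats1 -catA; exact: weq_cancel.
Qed.

Lemma nneg_combP i j (a b : R) y z : 0 <= a -> 0 <= b -> nneg y -> nneg z ->
  nneg (a *: y + b *: z).
Proof. by move=> a0 b0 y0 z0 k; rewrite !mxE addr_ge0 // mulr_ge0. Qed.

Lemma nneg_action s i j y : nneg (waction_dual A s (sroot R i)) ->
  nneg (waction_dual A s (sroot R j)) -> nneg_comb i j y -> nneg (waction_dual A s y).
Proof.
move=> si sj [a [b [a0 b0 ->]]]; rewrite linearD !linearZ /=.
exact: nneg_combP.
Qed.

Lemma root_absurd s i : nneg (waction_dual A s (sroot R i)) ->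
  nneg (- waction_dual A s (sroot R i)) -> False.
Proof. by move=> p q; have := root_neq0 A s i; rewrite (nnegN p q) eqxx. Qed.

(** Reducedness in terms of roots: a letter may be appended as long as its root is still positive.
    No length function on the group is required. *)
Inductive reduced : seq I -> Prop :=
| reduced_nil : reduced [::]
| reduced_rcons s i of reduced s & nneg (waction_dual A s (sroot R i)) :
    reduced (rcons s i).

Lemma reduced_alt u i j t : reduced u ->
  (forall t', (t' < t)%N -> nneg (waction_dual A u (alt_root A i j t'))) ->
  reduced (u ++ alt i j t).
Proof.
move=> ru; elim: t => [|t IH] p; first by rewrite cats0.
rewrite alt_rcons -rcons_cat; apply: reduced_rcons.
  by apply: IH => t' /ltnW; apply: p.
by rewrite waction_dual_cat; apply: p.
Qed.

(** The exchange condition: a root that is not positive allows the word to be rewritten with last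
    letter [i] after a shorter reduced prefix. *)
Let exchange s i := nneg (waction_dual A s (sroot R i)) \/
  exists s', [/\ reduced s', (size s' < size s)%N,
     nneg (waction_dual A s' (sroot R i)) & weq s (rcons s' i)].

(* Going down from [s] alternately along [j] and [i], as long as possible, ends
   at a minimal element [u] of the coset of the dihedral group. *)
Let descend N i j s :
  (forall s' k, (size s' < N)%N -> reduced s' -> exchange s' k) ->
  (size s < N)%N -> reduced s -> nneg (waction_dual A s (sroot R j)) ->
  exists k0 k1 k u, [/\ (k0 = i /\ k1 = j) \/ (k0 = j /\ k1 = i),
     reduced u /\ (size u + k <= size s)%N, nxt k0 k1 k = j,
     nneg (waction_dual A u (sroot R i)) /\ nneg (waction_dual A u (sroot R j)) &
     weq s (u ++ alt k0 k1 k) /\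
     forall t, (t <= k)%N -> nneg (waction_dual A u (alt_root A k0 k1 t))].
Proof.
move=> ex; move: {2}(size s) (leqnn (size s)) => M.
elim: M s i j => [|M IH] s i j sM sN rs sj.
  have -> : s = [::] by case: s sM {sN rs sj}.
  exists j, i, 0%N, [::]; split=> //; first by right.
  - by split=> //; apply: reduced_nil.
  - by split; apply: sroot_nneg.
  - by split=> [|[|//] _]; [apply: weq_refl | apply: sroot_nneg].
case: (ex s i sN rs) => [si|[s' [rs' s's s'i es]]].
  exists j, i, 0%N, s; split=> //; first by right.
  - by rewrite addn0.
  - by split=> [|[|//] _]; rewrite ?cats0 //; apply: weq_refl.
have s'M : (size s' <= M)%N by rewrite -ltnS (leq_trans s's).
have s'N := ltn_trans s's sN.
case: (IH s' j i s'M s'N rs' s'i) => k0 [k1 [k [u [kij [ru su ek [uj ui] [eu p]]]]]].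
have esu : weq s (u ++ alt k0 k1 k.+1).
  by apply: weq_trans es _; rewrite alt_rcons ek -rcons_cat; apply: weq_rcons.
have ek1 : nxt k0 k1 k.+1 = j.
  by move: ek; rewrite nxtS /nxt; case: odd kij => -[[-> ->]|[-> ->]] // ->.
exists k0, k1, k.+1, u; split=> //.
- by case: kij; [right | left].
- by split=> //; rewrite addnS (leq_ltn_trans su).
split=> // t; rewrite leq_eqVlt => /orP[/eqP ->|/p //].
rewrite /alt_root ek1 -waction_dual_cat.
by rewrite -(eq_waction_dual (weq_waction esu)).
Qed.

(** Strong induction on the length. With [j] the last letter, [s] is written as a minimal element
    [u] of its coset under the dihedral group of [i] and [j], followed by an alternating word. The
    sign of the root is then decided in rank two, since [u] keeps nonnegative combinations of
    alpha_i and alpha_j nonnegative. *)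
Lemma reduced_exchange s i : reduced s -> exchange s i.
Proof.
move: {2}(size s).+1 (ltnSn (size s)) => N; elim: N s i => // N IH s i sN rs.
case: {-1}s / rs (erefl s) => [|v j rv vj] es.
  by left; apply: sroot_nneg.
rewrite -es in sN *.
have vs : (size v < size s)%N by rewrite es size_rcons.
have vN : (size v < N)%N by apply: leq_trans vs _.
have [<-|ij] := eqVneq j i.
  by right; exists v; split=> //; rewrite es; apply: weq_refl.
have [k0 [k1 [k [u [kij [ru su] ek [ui uj] [eu p]]]]]] := descend i IH vN rv vj.
have {}es : weq s (u ++ alt k0 k1 k.+1).
  by rewrite es alt_rcons ek -rcons_cat; apply: weq_rcons.
have ek1 : nxt k0 k1 k.+1 = i.
  by move: ek; rewrite nxtS /nxt; case: odd kij => -[[-> ->]|[-> ->]] // ->.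
have es1 : waction_dual A s (sroot R i) = waction_dual A u (alt_root A k0 k1 k.+1).
  by rewrite (eq_waction_dual (weq_waction es)) waction_dual_cat /alt_root ek1.
have k01 : k0 != k1.
  by case: kij => -[-> ->]; rewrite // eq_sym.
have [u0 u1] : nneg (waction_dual A u (sroot R k0)) /\ nneg (waction_dual A u (sroot R k1)).
  by case: kij => -[-> ->].
case: (rank2_dichotomy A k01) => [[m [o pm]]|pinf]; last first.
  by left; rewrite es1; apply: nneg_action (pinf _).
have o' := coxeter_order_sym o.
have := coxeter_order_gt0 o; case: m o o' pm => // m o o' pm _.
have p' t : (t < m.+1)%N -> nneg (waction_dual A u (alt_root A k1 k0 t)).
  by move=> tm; apply: nneg_action (alt_root_nneg o' tm).
have rm : alt_root A k0 k1 m.+1 = - alt_root A k1 k0 m by rewrite (alt_root_order o).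
have [km|mk|km] := ltngtP k.+1 m.+1.
- by left; rewrite es1; apply: nneg_action (pm _ km).
(* The descent cannot be longer than the dihedral order: the root number [m.+1] would be nonnegative
   and also the opposite of a nonnegative root. *)
- have := p m.+1; rewrite rm linearN -ltnS mk => /(_ isT) q.
  have := root_neq0 A (u ++ alt k1 k0 m) (nxt k1 k0 m).
  by rewrite waction_dual_cat (nnegN (p' m (ltnSn m)) q) eqxx.
(* The alternating word has exactly the length of a braid relation, and its other side ends in
   [i]. *)
right; exists (u ++ alt k1 k0 m); split.
- by apply: reduced_alt => // t /ltnW; apply: p'.
- by rewrite size_cat size_alt; case: km => <-; rewrite (leq_ltn_trans su).
- have := p' m (ltnSn m); rewrite waction_dual_cat /alt_root.
  by rewrite -(nxtS k0 k1) -km ek1.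
apply: weq_trans es _; rewrite km rcons_cat.
have -> : rcons (alt k1 k0 m) i = alt k1 k0 m.+1.
  by rewrite alt_rcons -(nxtS k0 k1) -km ek1.
by have := weq_braid u [::] o; rewrite !cats0.
Qed.

Lemma weq_reduced s : exists2 s', weq s s' & reduced s'.
Proof.
elim/last_ind: s => [|s i [s' e rs']].
  by exists [::]; [apply: weq_refl | apply: reduced_nil].
case: (reduced_exchange i rs') => [p|[s'' [rs'' _ _ e'']]].
  by exists (rcons s' i); [apply: weq_rcons | apply: reduced_rcons].
exists s'' => //; apply: weq_trans (weq_rcons i (weq_trans e e'')) _.
exact: weq_rcons2.
Qed.

Lemma root_sign s i :
  nneg (waction_dual A s (sroot R i)) \/ nneg (- waction_dual A s (sroot R i)).
Proof.
have [s' /weq_waction/eq_waction_dual e rs'] := weq_reduced s; rewrite e.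
case: (reduced_exchange i rs') => [p|[s'' [_ _ p /weq_waction/eq_waction_dual ->]]].
  by left.
by right; rewrite waction_dual_rcons srefl_dual_sroot_diag linearN opprK.
Qed.

(** A nonempty reduced word with last letter [j] sends alpha_j to a negative root. *)
Lemma nneg_roots_id s :
  (forall i, nneg (waction_dual A s (sroot R i))) -> weq s [::].
Proof.
have [s' e rs'] := weq_reduced s; move: (eq_waction_dual (weq_waction e)) => es p.
case: {-1}s' / rs' (erefl s') => [|v j rv vj] E; first by rewrite -E.
case: (root_absurd vj); have := p j.
by rewrite es E waction_dual_rcons srefl_dual_sroot_diag linearN.
Qed.

Lemma waction_weq s s' : waction A s =1 waction A s' -> weq s s'.
Proof.
move=> e; have id_ss' : weq (s ++ rev s') [::].
  apply: nneg_roots_id => i; rewrite waction_dual_cat (eq_waction_dual e).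
  by rewrite waction_dualVK; apply: sroot_nneg.
have := weq_cat [::] s' id_ss'; rewrite /= -catA => es'.
apply: weq_trans es'; apply: weq_sym.
by have := weq_cat s [::] (weq_rev (rev s')); rewrite revK !cats0.
Qed.

End WordProblem.

(** * Signed walks *)

Section SignedWalks.
Variables (R : realType) (n : nat) (A : affine_cartan R n).
Local Notation I := 'I_n.+1.
Local Notation h := 'rV[R]_n.+1.
Implicit Types (x y : h) (i j : I) (s u v : seq I).

(** No real root vanishes at [x], so every step of a walk seen from [x] has a definite sign. *)
Definition regular_point x : Prop := forall s i, waction A s x 0 i != 0.

Lemma regular_waction s x : regular_point x -> regular_point (waction A s x).
Proof. by move=> r u i; rewrite -waction_cat. Qed.

Lemma regular_srefl i x : regular_point x -> regular_point (srefl A i x).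
Proof. exact: (@regular_waction [:: i]). Qed.

Lemma waction_rev_coord s x i :
  waction A (rev s) x 0 i = pairing x (waction_dual A s (sroot R i)).
Proof. by rewrite pairing_waction_dual pairing_sroot. Qed.

Lemma alt_coord i j k x :
  waction A (rev (alt i j k)) x 0 (nxt i j k) = pairing x (alt_root A i j k).
Proof. by rewrite waction_rev_coord. Qed.

Lemma alt_coordS i j k x :
  waction A (rev (alt i j k.+1)) x 0 (nxt i j k) = - pairing x (alt_root A i j k).
Proof.
by rewrite alt_rcons rev_rcons -alt_coord -[LHS]/(srefl A _ _ 0 _) srefl_coord.
Qed.

Lemma alt_subset i j k : {subset alt i j k <= [:: i; j]}.
Proof.
elim: k i j => //= k IH i j z; rewrite inE => /orP[/eqP ->|/IH].
  by rewrite inE eqxx.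
by rewrite !inE orbC.
Qed.

(** The string starts at alpha_i, positive at [x], then reaches a positive multiple of alpha_j and
    next a negative multiple of alpha_i; one of these two is negative at [x], so the sign changes
    somewhere. *)
Lemma alt_negative x i j m : regular_point x -> coxeter_order A i j m -> 0 < x 0 i ->
  exists2 k, pairing x (alt_root A i j k) > 0 &
             pairing x (alt_root A i j k.+1) < 0.
Proof.
move=> rx o xi.
have ex : exists k, pairing x (alt_root A i j k) < 0.
  have [xj|xj] : x 0 j < 0 \/ x 0 j > 0.
    by apply/orP; rewrite -neq_lt; apply: (rx [::]).
  - have [a a0 e] := alt_root_last o; exists m.-1.
    by rewrite e pairingZr pairing_sroot pmulr_rlt0.
  - have [a a0 e] := alt_root_last (coxeter_order_sym o); exists m.
    by rewrite alt_root_order // e pairingNr pairingZr pairing_sroot oppr_lt0 mulr_gt0.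
case: (ex_minnP ex) => -[|k] neg min.
  by move: neg; rewrite alt_root0 pairing_sroot ltNge ltW.
exists k => //; rewrite lt_neqAle eq_sym -{1}alt_coord rx /=.
by rewrite leNgt; apply/negP => /min; rewrite ltnn.
Qed.

Lemma dihedral_antidominant x i j m : regular_point x -> coxeter_order A i j m ->
  exists c, [/\ {subset c <= [:: i; j]}, waction A c x 0 i < 0 & waction A c x 0 j < 0].
Proof.
move=> rx o.
wlog : i j o / 0 < x 0 i.
  move=> H; have [xi|xi] : x 0 i < 0 \/ x 0 i > 0.
  - by apply/orP; rewrite -neq_lt; apply: (rx [::]).
  - have [xj|xj] : x 0 j < 0 \/ x 0 j > 0.
      by apply/orP; rewrite -neq_lt; apply: (rx [::]).
    + by exists [::].
    + have [c [sub cj ci]] := H j i (coxeter_order_sym o) xj.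
      by exists c; split=> // z /sub; rewrite !inE orbC.
  - exact: H o xi.
move=> xi; have [k pos neg] := alt_negative rx o xi.
(* Just after the first change of sign both coordinates are negative: one is the new negative value,
   the other the opposite of the last positive value. *)
exists (rev (alt i j k.+1)).
have c1 : waction A (rev (alt i j k.+1)) x 0 (nxt i j k) < 0.
  by rewrite alt_coordS oppr_lt0.
have c2 : waction A (rev (alt i j k.+1)) x 0 (nxt i j k.+1) < 0 by rewrite alt_coord.
split=> [z||].
- by rewrite mem_rev; apply: alt_subset.
- by move: c1 c2; rewrite /nxt oddS; case: odd.
- by move: c1 c2; rewrite /nxt oddS; case: odd.
Qed.

Section Walk.
Variables (U : Type) (e : U) (op : Monoid.law e) (t t' : I -> U).
Hypotheses (tK : forall i, op (t i) (t' i) = e) (t'K : forall i, op (t' i) (t i) = e).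
Hypothesis t_braid : forall i j m, coxeter_order A i j m ->
  \big[op/e]_(k < m) t (nxt i j k) = \big[op/e]_(k < m) t (nxt j i k).

(* For an alcove walk [s] starting from the alcove of [u], take [x = u^-1 rho]: the
   step from [v] to [v s_i] is then positive iff [<rho, v alpha_i> < 0]. *)
Fixpoint signed_walk x s : U :=
  if s is i :: s' then
    op (if x 0 i < 0 then t i else t' i) (signed_walk (srefl A i x) s')
  else e.

Lemma signed_walk_cat x s s' : signed_walk x (s ++ s') =
  op (signed_walk x s) (signed_walk (waction A (rev s) x) s').
Proof.
elim: s x => [|i s IH] x /=; first by rewrite Monoid.mul1m.
by rewrite IH Monoid.mulmA rev_cons waction_rcons.
Qed.

Lemma signed_walk_rcons x s i : signed_walk x (rcons s i) =
  op (signed_walk x s) (if waction A (rev s) x 0 i < 0 then t i else t' i).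
Proof. by rewrite -cats1 signed_walk_cat /= Monoid.mulm1. Qed.

Lemma signed_walk_twice x i : regular_point x -> signed_walk x [:: i; i] = e.
Proof.
move=> rx /=; rewrite srefl_coord oppr_lt0 Monoid.mulm1.
by have := rx [::] i; case: ltgtP => //=; rewrite ?eqxx // ?tK ?t'K.
Qed.

Lemma signed_walk_cancel x u v i : regular_point x ->
  signed_walk x (u ++ [:: i; i] ++ v) = signed_walk x (u ++ v).
Proof.
move=> rx; rewrite !signed_walk_cat signed_walk_twice; last exact: regular_waction.
by rewrite Monoid.mul1m -[rev [:: i; i]]/[:: i; i] /= sreflK.
Qed.

Lemma signed_walk_catrev x s : regular_point x -> signed_walk x (s ++ rev s) = e.
Proof.
move=> rx; elim/last_ind: s => //= s i IH.
by rewrite rev_rcons -cats1 -catA (@signed_walk_cancel x s (rev s) i).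
Qed.

Lemma signed_walk_rev x s : regular_point x -> waction A s =1 id ->
  signed_walk x s = e -> signed_walk x (rev s) = e.
Proof.
move=> rx ids xs; have := signed_walk_catrev s rx.
by rewrite signed_walk_cat xs Monoid.mul1m (eq_waction_rev (s' := [::]) ids).
Qed.

(** Appending the trivial pair [i i] exhibits the relator at [x] as the conjugate, by one step, of
    the relator at [s_i x]. *)
Lemma signed_walk_conj x i j m : regular_point x -> coxeter_order A i j m ->
  signed_walk (srefl A i x) (alt j i m.*2) = e -> signed_walk x (alt i j m.*2) = e.
Proof.
move=> rx o xm.
have -> : signed_walk x (alt i j m.*2) = signed_walk x (i :: alt j i m.*2 ++ [:: i]).
  rewrite -cat_cons -[i :: alt j i _]/(alt i j m.*2.+1) alt_rcons.
  rewrite /nxt odd_double -cats1 -catA.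
  by rewrite (@signed_walk_cancel x _ [::] i) // cats0.
rewrite /= signed_walk_cat xm Monoid.mul1m rev_alt_double.
rewrite (coxeter_order_double o).
exact: (signed_walk_twice i rx).
Qed.

Lemma signed_walk_alt_negative x i j m :
  (forall k, (k < m)%N -> pairing x (alt_root A i j k) < 0) ->
  signed_walk x (alt i j m) = \big[op/e]_(k < m) t (nxt i j k).
Proof.
elim: m => [|m IH] neg; first by rewrite big_ord0.
rewrite alt_rcons signed_walk_rcons alt_coord neg // big_ord_recr /= IH // => k km.
by apply: neg; rewrite ltnW.
Qed.

(** Each side of the braid relation crosses only hyperplanes whose roots are negative at [x], so all
    its steps are positive and the unsigned relation [t_braid] applies. *)
Lemma signed_walk_antidominant x i j m : regular_point x -> coxeter_order A i j m ->
  x 0 i < 0 -> x 0 j < 0 -> signed_walk x (alt i j m.*2) = e.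
Proof.
move=> rx o xi xj.
have neg i' j' : coxeter_order A i' j' m -> x 0 i' < 0 -> x 0 j' < 0 ->
  forall k, (k < m)%N -> pairing x (alt_root A i' j' k) < 0.
  move=> {}o {}xi {}xj k km; rewrite lt_neqAle -{1}alt_coord rx /=.
  have [a [b [a0 b0 ->]]] := alt_root_nneg o km.
  rewrite pairingDr !pairingZr !pairing_sroot; nra.
rewrite -alt_catrev signed_walk_cat.
rewrite (signed_walk_alt_negative (neg i j o xi xj)) (t_braid o).
rewrite (eq_waction_rev (waction_braid o)).
rewrite -(signed_walk_alt_negative (neg j i (coxeter_order_sym o) xj xi)).
by rewrite -signed_walk_cat signed_walk_catrev.
Qed.

(** Induction on a word in [i] and [j] leading to the antidominant point: each letter conjugates the
    relator, which is reversed where needed so that it starts with that letter. *)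
Lemma signed_walk_relator x i j m : regular_point x -> coxeter_order A i j m ->
  signed_walk x (alt i j m.*2) = e.
Proof.
move=> rx o; have [c [sub ci cj]] := dihedral_antidominant rx o.
elim/last_ind: c x rx i j o sub ci cj => [|c k IH] x rx i j o sub ci cj.
  exact: signed_walk_antidominant ci cj.
have o' := coxeter_order_sym o.
have Hk : k \in [:: i; j] by apply: sub; rewrite mem_rcons inE eqxx.
have sub' : {subset c <= [:: i; j]}.
  by move=> z zc; apply: sub; rewrite mem_rcons inE zc orbT.
rewrite !waction_rcons in ci cj.
have rkx := regular_srefl k rx.
have H := IH _ rkx i j o sub' ci cj.
have H' : signed_walk (srefl A k x) (alt j i m.*2) = e.
  by rewrite -rev_alt_double signed_walk_rev //; apply: coxeter_order_double.
move: Hk; rewrite !inE => /orP[] /eqP kE; rewrite {}kE in H H'.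
  exact: signed_walk_conj H'.
rewrite -rev_alt_double signed_walk_rev //; first exact: coxeter_order_double.
exact: signed_walk_conj H.
Qed.

Lemma signed_walk_braid x i j m : regular_point x -> coxeter_order A i j m ->
  signed_walk x (alt i j m) = signed_walk x (alt j i m).
Proof.
move=> rx o; set s := alt i j m; set s' := alt j i m.
have H : signed_walk x (s ++ rev s') = e.
  by rewrite alt_catrev; apply: signed_walk_relator.
transitivity (signed_walk x (s ++ (rev s' ++ s'))).
  rewrite signed_walk_cat -{2}[s']revK signed_walk_catrev ?Monoid.mulm1 //.
  exact: regular_waction.
rewrite catA signed_walk_cat H Monoid.mul1m alt_catrev rev_alt_double.
by rewrite (coxeter_order_double (coxeter_order_sym o)).
Qed.

Lemma signed_walk_weq x s s' : regular_point x -> weq A s s' ->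
  signed_walk x s = signed_walk x s'.
Proof.
move=> rx; elim=> // {s s'} [s1 s2 s3 _ e1 _ e2|u v i|u v i j m o].
- by rewrite e1.
- exact: signed_walk_cancel.
rewrite !signed_walk_cat (signed_walk_braid _ o); last exact: regular_waction.
by rewrite (eq_waction_rev (waction_braid o)).
Qed.

Lemma eq_signed_walk x s s' : regular_point x -> waction A s =1 waction A s' ->
  signed_walk x s = signed_walk x s'.
Proof. by move=> rx /waction_weq; apply: signed_walk_weq. Qed.

End Walk.

End SignedWalks.

(** * Real roots and the walls between adjacent alcoves *)

Section Roots.
Variables (R : realType) (n : nat) (A : affine_cartan R n).
Local Notation I := 'I_n.+1.
Local Notation h := 'rV[R]_n.+1.
Implicit Types (x y a av : h) (i j : I) (s u v : seq I).

Definition real_root y : Prop := exists s i, y = waction_dual A s (sroot R i).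

Lemma real_root_waction s y : real_root y -> real_root (waction_dual A s y).
Proof. by move=> [u [i ->]]; exists (s ++ u), i; rewrite waction_dual_cat. Qed.

Lemma waction_dual_int s y : (forall k, exists z : int, y 0 k = z%:~R) ->
  forall k, exists z : int, waction_dual A s y 0 k = z%:~R.
Proof.
elim: s => //= i s IH /IH {}IH k.
have [z zE] : exists z : int, pairing (scoroot A i) (waction_dual A s y) = z%:~R.
  have [z zP] := boolp.choice IH.
  exists (\sum_k A i k * z k); rewrite rmorph_sum; apply: eq_bigr => k' _ /=.
  by rewrite mxE zP rmorphM.
have [t e] := IH k; exists (t - z * (k == i)%:R).
rewrite /= -/(waction_dual A s y) /srefl_dual zE.
by rewrite !mxE e rmorphB rmorphM /=; case: (k == i).
Qed.

Lemma real_root_int y k : real_root y -> exists z : int, y 0 k = z%:~R.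
Proof.
move=> [s [i ->]]; apply: waction_dual_int => {}k.
by exists (k == i)%:R; rewrite mxE /=; case: (k == i).
Qed.

Lemma real_root_sign y : real_root y -> nneg y \/ nneg (- y).
Proof. by move=> [s [i ->]]; apply: root_sign. Qed.

Lemma real_root_neq0 y : real_root y -> y != 0.
Proof. by move=> [s [i ->]]; apply: root_neq0. Qed.

Lemma real_root_multiple y j (b : R) : real_root y -> y = b *: sroot R j ->
  0 <= b -> y = sroot R j.
Proof.
move=> ry yE b0; have [s [i e]] := ry.
have [z zE] := real_root_int j ry; move: zE; rewrite yE !mxE !eqxx mulr1 => bz.
have e' : sroot R i = b *: waction_dual A (rev s) (sroot R j).
  by rewrite -linearZ -yE e /= waction_dualK.
have rr : real_root (waction_dual A (rev s) (sroot R j)) by exists (rev s), j.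
have [t tE] := real_root_int i rr.
have := congr1 (fun v : h => v 0 i) e'; rewrite [RHS]mxE tE mxE !eqxx bz.
rewrite -rmorphM -[1%:R]/(1%:~R) => /intr_inj zt.
have z0 : 0 <= z by rewrite -(ler0z R) -bz.
suff -> : z = 1 by rewrite scale1r.
have [z1|[//|z2]] : z = 0 \/ z = 1 \/ 2 <= z by lia.
  by rewrite z1 mul0r in zt.
have [t0|t0] : t <= 0 \/ 1 <= t by lia.
  by nia.
by nia.
Qed.

(** [s_j] changes only coordinate [j], so any other nonzero coordinate keeps its sign and determines
    that of the image. *)
Lemma real_root_srefl y j : real_root y -> nneg y ->
  y = sroot R j \/ nneg (srefl_dual A j y).
Proof.
move=> ry y0; have [[k kj yk]|H] := pselect (exists2 k, k != j & y 0 k != 0).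
  have := real_root_waction [:: j] ry => /real_root_sign[|/(_ k)]; first by right.
  by rewrite mxE /= srefl_dual_coord // oppr_ge0 => yk0; rewrite eq_le yk0 y0 in yk.
left; apply: (@real_root_multiple _ j (y 0 j)) => //.
apply/rowP => k; rewrite !mxE; case: (eqVneq k j) => [->|kj]; first by rewrite mulr1.
by rewrite mulr0; apply/eqP/negPn/negP => yk; apply: H; exists k.
Qed.

(* The wall between the alcoves [1] and [s_j] is the only one which separates them. *)
Lemma real_root_separation y j x : (forall i, 0 < x 0 i) -> real_root y ->
  0 < pairing x y -> pairing (srefl A j x) y < 0 -> y = sroot R j.
Proof.
move=> x0; have pos z : nneg z -> 0 <= pairing x z.
  by move=> z0; apply: sumr_ge0 => i _; rewrite mulr_ge0 // ltW.
move=> ry y1 y2; have y0 : nneg y.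
  case: (real_root_sign ry) => // /pos; rewrite pairingNr oppr_ge0.
  by rewrite leNgt y1.
case: (real_root_srefl j ry y0) => // /pos.
by rewrite -pairing_srefl leNgt y2.
Qed.

Lemma pairing_real_root_neq0 y x : (forall i, 0 < x 0 i) -> real_root y ->
  pairing x y != 0.
Proof.
move=> x0 ry.
have pos z : nneg z -> pairing x z = 0 -> z = 0.
  move=> z0 /eqP; rewrite psumr_eq0 => [/allP z0'|i _]; last first.
    by rewrite mulr_ge0 // ltW.
  apply/rowP => i; rewrite mxE; have := z0' i (mem_index_enum _).
  by rewrite mulf_eq0 gt_eqF //= => /eqP.
apply/eqP => e; have := real_root_neq0 ry.
case: (real_root_sign ry) => /pos; rewrite ?pairingNr e ?oppr0 => /(_ erefl).
  by move=> ->; rewrite eqxx.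
by move/eqP; rewrite oppr_eq0 => ->.
Qed.

(** Up to a sign, [B y] is nonnegative, which in affine type forces [B y = 0]. The kernel of [B] is
    the line spanned by [delta], whose coordinate 0 is nonzero. *)
Lemma affine_nondegenerate y : y 0 ord0 = 0 ->
  (forall j : 'I_n, pairing (scoroot A (fnode j)) y = 0) -> y = 0.
Proof.
wlog p0 : y / 0 <= pairing (scoroot A ord0) y => [H y0 yj|].
  have [p0|/ltW p0] := lerP 0 (pairing (scoroot A ord0) y); first exact: H.
  rewrite -[y]opprK (H (- y)) ?oppr0 //.
  - by rewrite pairingNr oppr_ge0.
  - by rewrite mxE y0 oppr0.
  - by move=> j; rewrite pairingNr yj oppr0.
move=> y0 yj.
pose B : 'M[R]_n.+1 := map_mx intr A.
have BE z i : (B *m z^T) i 0 = pairing (scoroot A i) z.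
  by rewrite mxE; apply: eq_bigr => k _; rewrite !mxE.
have [rkB _ Bpos] := cartan_affine A.
have By : B *m y^T = 0.
  apply: Bpos => i; rewrite BE; case: (unliftP ord0 i) => [j ->|-> //].
  by rewrite -/(fnode j) yj.
have Bd : B *m (delta A)^T = 0.
  by apply/colP => i; rewrite BE pairing_delta mxE.
have ker (z : h) : B *m z^T = 0 -> (z <= kermx B^T)%MS.
  by move=> e; apply/sub_kermxP; rewrite -[z]trmxK -trmx_mul e trmx0.
have d0 : delta A != 0.
  apply/eqP => /rowP/(_ ord0); rewrite !mxE => /eqP; rewrite pnatr_eq0.
  by rewrite gtn_eqF // mark_gt0.
have rk1 : \rank (delta A) = \rank (kermx B^T).
  by rewrite mxrank_ker mxrank_tr rkB rank_rV d0 subSnn.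
have eqd : (delta A :=: kermx B^T)%MS.
  by apply/eqmxP; rewrite -(geq_leqif (mxrank_leqif_eq (ker _ Bd))) rk1.
have := ker _ By; rewrite -eqd => /sub_rVP[k yE].
move: y0; rewrite yE mxE => /eqP; rewrite mulf_eq0 => /orP[/eqP ->|].
  by rewrite scale0r.
by rewrite mxE pnatr_eq0 gtn_eqF // mark_gt0.
Qed.

End Roots.

(** * The finite root system *)

Lemma lattice_ind n (P : 'rV[int]_n -> Prop) : P 0 ->
  (forall la mu, P la -> P mu -> P (la + mu)) -> (forall la, P la -> P (- la)) ->
  (forall j, P (delta_mx 0 j)) -> forall la, P la.
Proof.
move=> P0 PD PN Pj la; rewrite [la]row_sum_delta; apply: (big_ind P) => // j _.
have Pn (k : nat) : P (delta_mx 0 j *+ k).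
  by elim: k => [|k IH]; rewrite ?mulr0n // mulrS; apply: PD.
case: (la 0 j) => k; first by rewrite -natz scaler_nat.
by rewrite NegzE scaleNr -natz scaler_nat; apply: PN.
Qed.

Section FiniteRoots.
Variables (R : realType) (n : nat) (A : affine_cartan R n).
Local Notation I := 'I_n.+1.
Local Notation h := 'rV[R]_n.+1.
Implicit Types (x y a av : h) (i j : 'I_n) (s : seq 'I_n) (la mu nu : 'rV[int]_n).

Lemma coroot_vec_is_zmod_morphism : zmod_morphism (coroot_vec A).
Proof.
move=> la mu; rewrite /coroot_vec -sumrB; apply: eq_bigr => i _.
by rewrite !mxE rmorphB scalerBl.
Qed.

HB.instance Definition _ := GRing.isZmodMorphism.Build 'rV[int]_n h (coroot_vec A)
  coroot_vec_is_zmod_morphism.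

Lemma height_is_zmod_morphism : zmod_morphism (@height n).
Proof.
by move=> la mu; rewrite /height -sumrB; apply: eq_bigr => i _; rewrite !mxE.
Qed.

HB.instance Definition _ := GRing.isZmodMorphism.Build 'rV[int]_n int (@height n)
  height_is_zmod_morphism.

Lemma height_delta i (z : int) : height (z *: delta_mx 0 i) = z.
Proof.
rewrite /height (bigD1 i) //= big1 => [|j /negPf ji]; rewrite !mxE ?eqxx ?ji.
  by rewrite mulr1 addr0.
by rewrite mulr0.
Qed.

Lemma coroot_vec_delta i (z : int) :
  coroot_vec A (z *: delta_mx 0 i) = z%:~R *: scoroot A (fnode i).
Proof.
rewrite /coroot_vec (bigD1 i) //= big1 => [|j /negPf ji]; rewrite !mxE ?eqxx ?ji.
  by rewrite mulr1 addr0.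
by rewrite mulr0 scale0r.
Qed.

Lemma coroot_vec_coord mu i :
  exists z : int, coroot_vec A mu 0 (fnode i) = z%:~R.
Proof.
exists (\sum_k mu 0 k * A (fnode k) (fnode i)).
rewrite summxE rmorph_sum; apply: eq_bigr => k _ /=.
by rewrite !mxE rmorphM.
Qed.

Lemma srefl_coroot_vec i mu (z : int) : coroot_vec A mu 0 (fnode i) = z%:~R ->
  srefl A (fnode i) (coroot_vec A mu) = coroot_vec A (mu - z *: delta_mx 0 i).
Proof. by move=> e; rewrite sreflE e raddfB /= coroot_vec_delta. Qed.

Lemma waction_coroot_vec s mu :
  exists nu, waction A (map (@fnode n) s) (coroot_vec A mu) = coroot_vec A nu.
Proof.
elim: s => [|i s [nu IH]]; first by exists mu.
have [z zE] := coroot_vec_coord nu i.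
by exists (nu - z *: delta_mx 0 i); rewrite -(srefl_coroot_vec zE) -IH.
Qed.

Lemma froot_coroot_vec a av : froot A a av -> exists mu, av = coroot_vec A mu.
Proof.
move=> [s [i [_ ->]]]; have [nu e] := waction_coroot_vec s (1 *: delta_mx 0 i).
by exists nu; rewrite -e coroot_vec_delta scale1r.
Qed.

Lemma froot_simple i : froot A (sroot R (fnode i)) (scoroot A (fnode i)).
Proof. by exists [::], i. Qed.

Lemma froot_waction s a av : froot A a av ->
  froot A (waction_dual A (map (@fnode n) s) a) (waction A (map (@fnode n) s) av).
Proof.
move=> [u [i [-> ->]]]; exists (s ++ u), i.
by rewrite map_cat waction_cat waction_dual_cat.
Qed.

Lemma frootN a av : froot A a av -> froot A (- a) (- av).
Proof.
move=> [s [i [-> ->]]]; exists (rcons s i), i.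
rewrite map_rcons waction_rcons waction_dual_rcons.
by rewrite srefl_scoroot srefl_dual_sroot_diag !linearN.
Qed.

Lemma froot_pairing a av : froot A a av -> pairing av a = 2.
Proof.
by move=> [s [i [-> ->]]]; rewrite pairing_waction2 pairing_sroot scoroot_diag.
Qed.

Lemma froot_real a av : froot A a av -> real_root A a.
Proof. by move=> [s [i [-> _]]]; eexists; eexists. Qed.

Lemma froot_coord0 a av : froot A a av -> a 0 ord0 = 0.
Proof.
move=> [s [i [-> _]]]; elim: s => [|j s IH] /=; first by rewrite mxE.
by rewrite srefl_dual_coord.
Qed.

Lemma froot_delta a av : froot A a av -> pairing av (delta A) = 0.
Proof.
by move=> [s [i [_ ->]]]; rewrite waction_delta pairing_delta.
Qed.

Lemma froot_sign a av : froot A a av -> pos_froot A a av \/ pos_froot A (- a) (- av).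
Proof.
move=> f; case: (real_root_sign (froot_real f)) => a0; first by left.
by right; split=> //; apply: frootN.
Qed.

Lemma pos_froot_simple i : pos_froot A (sroot R (fnode i)) (scoroot A (fnode i)).
Proof. by split; [apply: froot_simple | apply: sroot_nneg]. Qed.

Lemma froot_reflection a av : froot A a av ->
  exists s, forall x, waction A (map (@fnode n) s) x = x - pairing x a *: av.
Proof.
move=> [s [i [-> ->]]]; exists (s ++ i :: rev s) => x.
by rewrite map_cat map_cons map_rev waction_reflection.
Qed.

Lemma pairing_coord0 x a : a 0 ord0 = 0 ->
  pairing x a = \sum_i x 0 (fnode i) * a 0 (fnode i).
Proof. by move=> a0; rewrite /pairing big_ord_recl a0 mulr0 add0r. Qed.

Lemma pos_froot_pairing_gt0 x a av : (forall i, 0 < x 0 (fnode i)) ->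
  pos_froot A a av -> 0 < pairing x a.
Proof.
move=> x0 [f a0]; have az := froot_coord0 f; rewrite (pairing_coord0 _ az).
have p i : 0 <= x 0 (fnode i) * a 0 (fnode i) by rewrite mulr_ge0 // ltW.
rewrite lt_neqAle sumr_ge0 // andbT eq_sym psumr_eq0 //.
apply/negP => /allP e; have := real_root_neq0 (froot_real f); case/eqP.
apply/rowP => k; rewrite mxE; case: (unliftP ord0 k) => [i ->|-> //].
by have := e i (mem_index_enum _); rewrite mulf_eq0 gt_eqF //= => /eqP.
Qed.

Lemma pos_froot_pairing_lt0 x a av : (forall i, x 0 (fnode i) < 0) ->
  pos_froot A a av -> pairing x a < 0.
Proof.
move=> x0 /(@pos_froot_pairing_gt0 (- x)); rewrite pairingNl oppr_gt0; apply=> i.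
by rewrite mxE oppr_gt0.
Qed.

Lemma pos_froot_srefl i a av : pos_froot A a av -> a <> sroot R (fnode i) ->
  pos_froot A (srefl_dual A (fnode i) a) (srefl A (fnode i) av).
Proof.
move=> [f a0] ai; split; first exact: (@froot_waction [:: i]).
by case: (real_root_srefl (fnode i) (froot_real f) a0).
Qed.

Section HighestCoroot.
Variables (theta : 'rV[int]_n) (thetaP : highest_coroot A theta).

Lemma froot_le a mu i : froot A a (coroot_vec A mu) -> `|mu 0 i| <= theta 0 i.
Proof.
move=> f; rewrite ler_norml; have [_ le] := thetaP.
rewrite (le _ _ f) andbT lerNl.
by have := frootN f; rewrite -raddfN => /le/(_ i); rewrite mxE.
Qed.

(** The form in which the highest coroot is exploited: coordinates of coroots are bounded, so no
    infinite arithmetic progression of coroots exists unless it is constant. *)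
Lemma froot_progression mu nu :
  (forall k : nat, exists a, froot A a (coroot_vec A (mu + nu *+ k))) -> nu = 0.
Proof.
move=> f; apply/rowP => i; rewrite [RHS]mxE.
set x := nu 0 i; set b := theta 0 i; set m := mu 0 i.
have [N NE] : exists N : nat, N%:Z = `|b| + `|m| + 1.
  by exists (absz b + absz m + 1)%N; rewrite !PoszD !abszE.
have [a /(froot_le i)] := f N; rewrite !mxE mulmxnE -/x -/b -/m.
rewrite -mulr_natr natz => H; apply: contrapT => x0.
have [x1|x1] : 1 <= x \/ x <= -1 by lia.
  have := ler_wpM2r (le0z_nat N) x1; rewrite mul1r; lia.
have := ler_wpM2r (le0z_nat N) x1; rewrite mulN1r; lia.
Qed.

(** A relation between the simple coroots could be added to [theta] any number of times without
    changing the coroot. *)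
Lemma coroot_vec_inj : injective (coroot_vec A).
Proof.
move=> mu nu e; apply/eqP; rewrite -subr_eq0; apply/eqP.
apply: (@froot_progression theta) => k; have [[a f] _] := thetaP; exists a.
by rewrite raddfD raddfMn raddfB /= e subrr mul0rn addr0.
Qed.

End HighestCoroot.
End FiniteRoots.

(** * Uniqueness of coroots, finiteness, and the sum of the positive coroots *)

Section Rho.
Variables (R : realType) (n : nat) (A : affine_cartan R n).
Local Notation I := 'I_n.+1.
Local Notation h := 'rV[R]_n.+1.
Implicit Types (x y a av : h) (i j : 'I_n) (s : seq 'I_n) (la mu nu : 'rV[int]_n).
Variables (theta : 'rV[int]_n) (thetaP : highest_coroot A theta).

Lemma froot_orbit_progression a av mu (g : h -> h) :
  (forall x b, froot A b x -> exists b', froot A b' (g x)) ->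
  froot A a av -> (forall k : nat, iter k g av = av + coroot_vec A mu *+ k) ->
  mu = 0.
Proof.
move=> gf f it; have [nu nuE] := froot_coroot_vec f.
apply: (@froot_progression _ _ _ _ thetaP nu) => k.
rewrite raddfD raddfMn /= -nuE -it.
elim: k => [|k [b IH]]; first by exists a.
exact: gf IH.
Qed.

(** When the two reflections share their root or their coroot, this product is unipotent, and its
    powers move a coroot along an arithmetic progression. *)
Definition two_reflections a av b bv x : h :=
  let y := x - pairing x b *: bv in y - pairing y a *: av.

Lemma froot_two_reflections a b av bv : froot A a av -> froot A b bv ->
  forall x c, froot A c x -> exists c',
    froot A c' (two_reflections a av b bv x).
Proof.
move=> fa fb x c fc; have [s sE] := froot_reflection fa.
have [u uE] := froot_reflection fb.
eexists; rewrite /two_reflections /= -uE -sE.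
by apply: froot_waction; apply: froot_waction; exact: fc.
Qed.

Lemma froot_coroot_uniq a av av' : froot A a av -> froot A a av' -> av = av'.
Proof.
move=> f f'; have [mu muE] := froot_coroot_vec f; have [nu nuE] := froot_coroot_vec f'.
have H : (mu - nu) *+ 2 = 0.
  apply: (froot_orbit_progression (froot_two_reflections f f') f).
  have : coroot_vec A ((mu - nu) *+ 2) = 2 *: (av - av').
    by rewrite raddfMn raddfB /= -muE -nuE scaler_nat.
  move: (coroot_vec _ _) => w wE k.
  have wa : pairing w a = 0.
    by rewrite wE pairingZl pairingBl (froot_pairing f) (froot_pairing f') subrr mulr0.
  elim: k => [|k IH]; first by rewrite mulr0n addr0.
  rewrite iterS IH mulrSr addrA /two_reflections -scaler_nat /=.
  rewrite !(pairingDl, pairingNl, pairingZl) wa (froot_pairing f) (froot_pairing f').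
  by rewrite wE; apply/rowP => l; rewrite !mxE; ring.
have /(congr1 (coroot_vec A)) := H.
rewrite raddfMn raddfB raddf0 /= -muE -nuE -scaler_nat => /eqP.
by rewrite scaler_eq0 pnatr_eq0 subr_eq0 => /eqP.
Qed.

Lemma coroot_neq0 a av : froot A a av -> av != 0.
Proof.
move=> f; have := froot_pairing f; case: eqP => // ->.
by rewrite -[0](subrr 0) pairingBl subrr => /eqP; rewrite eq_sym pnatr_eq0.
Qed.

(** The product of the two reflections is [x + <x, a - a'> av]. Iterated on a simple coroot it gives
    a progression of coroots, so [a - a'] kills every finite simple coroot and nondegeneracy
    applies. *)
Lemma froot_root_uniq a a' av : froot A a av -> froot A a' av -> a = a'.
Proof.
move=> f f'; apply/eqP; rewrite -subr_eq0; apply/eqP.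
apply: (@affine_nondegenerate _ _ A) => [|j].
  by rewrite !mxE (froot_coord0 f) (froot_coord0 f') subrr.
set z := pairing _ _; have [mu muE] := froot_coroot_vec f.
have gx x : two_reflections a' av a av x = x + pairing x (a - a') *: av.
  rewrite /two_reflections /= !(pairingDl, pairingNl, pairingZl, pairingBr) (froot_pairing f').
  by apply/rowP => l; rewrite !mxE; ring.
have [nu nuE] : exists nu, z *: av = coroot_vec A nu.
  have [c fc] := froot_two_reflections f' f (froot_simple A j).
  have [nu nuE] := froot_coroot_vec fc.
  exists (nu - 1 *: delta_mx 0 j); rewrite raddfB /= coroot_vec_delta scale1r.
  by rewrite -nuE gx addrAC subrr add0r.
have nu0 : nu = 0.
  apply: (froot_orbit_progression (froot_two_reflections f' f) (froot_simple A j)).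
  elim=> [|k IH]; first by rewrite mulr0n addr0.
  rewrite iterS IH gx mulrSr addrA -nuE; congr (_ + _ *: _).
  rewrite pairingDl -/z -scaler_nat !pairingZl pairingBr.
  by rewrite (froot_pairing f) (froot_pairing f') subrr !mulr0 addr0.
move/eqP: nuE; rewrite nu0 raddf0 scaler_eq0 (negPf (coroot_neq0 f)) orbF.
by move/eqP.
Qed.

Lemma pos_coroots_finite : finite_set (pos_coroots A).
Proof.
pose K := (\sum_i absz (theta 0%R i))%N.
pose F (f : {ffun 'I_n -> 'I_K.*2.+1}) : h :=
  coroot_vec A (\row_i ((f i : nat)%:Z - K%:Z)).
apply: (@sub_finite_set _ _ (F @` setT)%classic); last first.
  by apply: finite_image; apply: finite_finset.
move=> av0 [a [f _]]; have [mu muE] := froot_coroot_vec f; rewrite muE in f *.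
have bd i : - K%:Z <= mu 0 i <= K%:Z.
  rewrite -ler_norml (le_trans (froot_le thetaP i f)) //.
  rewrite (le_trans (ler_norm _)) // -abszE lez_nat /K.
  by rewrite (bigD1 i) //= leq_addr.
exists [ffun i => inord (absz (mu 0 i + K%:Z))] => //.
rewrite /F; congr coroot_vec; apply/rowP => i; rewrite mxE ffunE.
have := bd i => bi; rewrite inordK; last by rewrite ltnS; lia.
by rewrite gez0_abs; lia.
Qed.

Definition two_rho : h := (\sum_(av \in pos_coroots A) av)%R.

Lemma pos_coroots_simple i : pos_coroots A (scoroot A (fnode i)).
Proof. by exists (sroot R (fnode i)); apply: pos_froot_simple. Qed.

Lemma pos_coroots_srefl i av : (pos_coroots A `\ scoroot A (fnode i))%classic av ->
  (pos_coroots A `\ scoroot A (fnode i))%classic (srefl A (fnode i) av).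
Proof.
move=> [[a fa] /= avi]; have ai : a <> sroot R (fnode i).
  by move=> e; apply: avi; rewrite e in fa; apply: froot_coroot_uniq fa.1 (froot_simple A i).
split; first by exists (srefl_dual A (fnode i) a); apply: pos_froot_srefl.
move=> /= e; have avE : av = - scoroot A (fnode i).
  by rewrite -[av](sreflK A (fnode i)) e srefl_scoroot.
case: fa => f a0; have f' := frootN (froot_simple A i).
rewrite avE in f; have aE := froot_root_uniq f f'.
have := a0 (fnode i); rewrite aE !mxE !eqxx oppr_ge0.
by rewrite leNgt ltr01.
Qed.

(** [s_i] permutes the positive coroots other than the i-th simple one, so their sum is fixed by
    [s_i] and has coordinate 0 there; only the simple coroot contributes. *)
Lemma two_rho_coord i : two_rho 0 (fnode i) = 2.
Proof.
rewrite /two_rho (fsbigD1 (scoroot A (fnode i))); last 2 first.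
- exact: pos_coroots_finite.
- exact: pos_coroots_simple.
set P := (_ `\ _)%classic; set S := (\sum_(_ \in P) _)%R.
have SE : srefl A (fnode i) S = S.
  have Pf : finite_set P by apply: finite_setD; apply: pos_coroots_finite.
  rewrite {1}/S fsbig_finite // raddf_sum /= -[LHS]fsbig_finite // /S.
  rewrite [RHS](reindex_fsbig (srefl A (fnode i)) P) //; split.
  - by move=> av avP; apply: pos_coroots_srefl.
  - by move=> x y _ _; apply: (can_inj (sreflK A (fnode i))).
  - move=> av avP; exists (srefl A (fnode i) av); last exact: sreflK.
    exact: pos_coroots_srefl.
have := congr1 (fun x : h => x 0 (fnode i)) SE; rewrite srefl_coord => S0.
by rewrite mxE scoroot_diag; lra.
Qed.

Lemma two_rho_h0 : pairing two_rho (delta A) = 0.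
Proof.
rewrite /two_rho fsbig_finite; last exact: pos_coroots_finite.
rewrite big_seq; elim/big_rec: _ => [|av x avP IH].
  by rewrite -[0](subrr 0) pairingBl subrr.
rewrite pairingDl IH addr0; move: avP; rewrite in_fset_set; last exact: pos_coroots_finite.
by rewrite inE => -[a [f _]]; apply: froot_delta f.
Qed.

Lemma rhoE : vsval (rho A) = 2^-1 *: two_rho.
Proof. by rewrite vsprojK // mem_h0 pairingZl two_rho_h0 mulr0. Qed.

Lemma froot_pairing_neq0 x a av : (forall i, 0 < x 0 (fnode i)) -> froot A a av ->
  pairing x a != 0.
Proof.
move=> x0 /froot_sign[] /(pos_froot_pairing_gt0 x0); first by move=> /gt_eqF ->.
by rewrite pairingNr oppr_gt0 => /lt_eqF ->.
Qed.

Lemma coroot_sum_lower_bound (L : seq h) s :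
  (forall av, av \in L -> exists a, froot A a av) ->
  exists nu, waction A (map (@fnode n) s) (\sum_(av <- L) av) = coroot_vec A nu /\
             - (height theta *+ size L) <= height nu.
Proof.
elim: L => [|av L IH] fL.
  by exists 0; rewrite big_nil linear0 raddf0 mulr0n; split=> //; rewrite oppr0 raddf0.
have [|nu [e le]] := IH; first by move=> bv bL; apply: fL; rewrite inE bL orbT.
have [a /(froot_waction s) f] := fL av (mem_head _ _).
have [mu muE] := froot_coroot_vec f.
exists (mu + nu); rewrite big_cons linearD /= e muE raddfD; split=> //.
rewrite raddfD /= mulrS opprD lerD // lerNl /height -sumrN ler_sum // => i _.
by rewrite muE in f; have := froot_le thetaP i f; rewrite ler_norml lerNl => /andP[].
Qed.

(** Reflecting at a positive coordinate lowers the height, and heights along the orbit are bounded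
    below because each of the finitely many summands remains a coroot, of height at least
    [- height theta]. *)
Lemma antidominant_two_rho : exists s, forall i,
  waction A (map (@fnode n) s) two_rho 0 (fnode i) < 0.
Proof.
have [K lb] : exists K : int, forall s mu,
    waction A (map (@fnode n) s) two_rho = coroot_vec A mu -> K <= height mu.
  pose L : seq h := fset_set (pos_coroots A).
  exists (- (height theta *+ size L)) => s mu e.
  have [av|nu [e' le]] := @coroot_sum_lower_bound L s.
    rewrite in_fset_set; last exact: pos_coroots_finite.
    by rewrite inE => -[a [f _]]; exists a.
  rewrite (_ : mu = nu) //; apply: (coroot_vec_inj thetaP); rewrite -e -e'.
  by rewrite /two_rho fsbig_finite //; apply: pos_coroots_finite.
suff H k s mu : waction A (map (@fnode n) s) two_rho = coroot_vec A mu ->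
    height mu <= K + k%:Z -> exists s, forall i,
    waction A (map (@fnode n) s) two_rho 0 (fnode i) < 0.
  have [|mu [e _]] := @coroot_sum_lower_bound (fset_set (pos_coroots A)) [::].
    move=> av; rewrite in_fset_set; last exact: pos_coroots_finite.
    by rewrite inE => -[a [f _]]; exists a.
  apply: (H (absz (height mu - K)) [::] mu).
    by rewrite -e /two_rho fsbig_finite //; apply: pos_coroots_finite.
  by rewrite abszE -lerBlDl ler_norm.
elim: k s mu => [|k IH] s mu e le.
(* The base case and the induction step run in parallel: in the former the reflected vector would
   fall below the bound [K], in the latter it feeds the induction. A zero coordinate is excluded, as
   no finite root vanishes on [two_rho]. *)
all: have [neg|/existsNP[i /negP]] := pselect (forall i,
    waction A (map (@fnode n) s) two_rho 0 (fnode i) < 0); try by exists s.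
all: rewrite -leNgt le_eqVlt => /orP[|pos].
1,3: rewrite eq_sym -pairing_sroot -[map _ s]revK -map_rev -pairing_waction_dual.
1,2: rewrite (negPf (froot_pairing_neq0 _ (froot_waction _ (froot_simple A i)))) //.
1,2: by move=> j; rewrite two_rho_coord.
all: have [z zE] := coroot_vec_coord A mu i.
all: have e' : waction A (map (@fnode n) (i :: s)) two_rho =
    coroot_vec A (mu - z *: delta_mx 0 i) by rewrite -(srefl_coroot_vec zE) -e.
all: have := lb _ _ e'; rewrite raddfB /= height_delta => le'.
all: have z_gt0 : 0 < z by rewrite -(ltr0z R) -zE -e.
  by lia.
apply: IH e' _; rewrite raddfB /= height_delta; lia.
Qed.

End Rho.

(** * Hyperplanes and translations *)

Section Hyperplanes.
Variables (R : realType) (n : nat) (A : affine_cartan R n).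
Local Notation I := 'I_n.+1.
Local Notation h := 'rV[R]_n.+1.
Implicit Types (x y a av : h) (i j : I) (s u v : seq I) (la mu nu : 'rV[int]_n).
Variables (theta : 'rV[int]_n) (thetaP : highest_coroot A theta).
Variables (c : h -> rat) (cP : reflection_spacing A c).

Lemma delta_coord_gt0 i : 0 < delta A 0 i.
Proof. by rewrite mxE ltr0n mark_gt0. Qed.

(** A reflection determines its root and coroot up to inverse scalars; this converts the spacing
    hypothesis, which speaks of reflections, into statements about roots. *)
Lemma rank_one_eq (b g bv gv : h) :
  (forall x, pairing x b *: bv = pairing x g *: gv) -> pairing bv b = 2 ->
  exists2 k : R, k != 0 & b = k *: g /\ gv = k *: bv.
Proof.
move=> e bb; pose t := pairing bv g / 2.
have bvE : bv = t *: gv.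
  apply: (@scalerI _ _ (2 : R)); first by rewrite pnatr_eq0.
  by rewrite scalerA /t mulrC divfK ?pnatr_eq0 // -e bb.
have bv0 : bv != 0.
  apply/eqP => bv0; move/eqP: bb; rewrite bv0 -[0](subrr 0) pairingBl subrr.
  by rewrite eq_sym pnatr_eq0.
have t0 : t != 0 by apply: contraNneq bv0 => t0; rewrite bvE t0 scale0r.
have gv0 : gv != 0 by apply: contraNneq bv0 => gv0; rewrite bvE gv0 scaler0.
exists t^-1; first by rewrite invr_eq0.
split; last by rewrite bvE scalerA mulVf ?scale1r.
apply: pairing_inj => x; rewrite pairingZr.
apply: (mulfI t0); rewrite mulrA divff // mul1r mulrC.
have := e x; rewrite {1}bvE scalerA => /eqP; rewrite -subr_eq0 -scalerBl.
by rewrite scaler_eq0 (negPf gv0) orbF subr_eq0 => /eqP.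
Qed.

Lemma affine_reflE a av (m : R) x :
  affine_refl A a av m x = x - pairing x (a - m *: delta A) *: av.
Proof. by []. Qed.

Lemma real_root_hyperplane s i : exists a av (k : int) (t : R),
  [/\ pos_froot A a av, t != 0 &
      waction_dual A s (sroot R i) = t *: (a - (k%:~R * ratr (c a)) *: delta A)].
Proof.
have [a [av [k [f e]]]] : exists a av (k : int), pos_froot A a av /\
    waction A (s ++ i :: rev s) =1 affine_refl A a av (k%:~R * ratr (c a)).
  by have [_ H] := cP; apply/H; exists s, i.
exists a, av, k; have [x||t t0 [bE _]] := @rank_one_eq
    (waction_dual A s (sroot R i)) (a - (k%:~R * ratr (c a)) *: delta A)
    (waction A s (scoroot A i)) av.
- by have := e x; rewrite waction_reflection affine_reflE => /addrI/oppr_inj.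
- by rewrite pairing_waction2 pairing_sroot scoroot_diag.
- by exists t.
Qed.

Lemma real_rootN y : real_root A y -> real_root A (- y).
Proof.
move=> [s [i ->]]; exists (rcons s i), i.
by rewrite waction_dual_rcons srefl_dual_sroot_diag linearN.
Qed.

Lemma hyperplane_real_root a av (k : int) : pos_froot A a av ->
  exists y (t : R), [/\ real_root A y, 0 < t &
    y = t *: (a - (k%:~R * ratr (c a)) *: delta A)].
Proof.
move=> f; have [s [i e]] : is_reflection A (affine_refl A a av (k%:~R * ratr (c a))).
  by have [_ H] := cP; apply/H; exists a, av, k.
have [x||t t0 [bE _]] := @rank_one_eq
    (waction_dual A s (sroot R i)) (a - (k%:~R * ratr (c a)) *: delta A)
    (waction A s (scoroot A i)) av.
- by have := e x; rewrite waction_reflection affine_reflE => /addrI/oppr_inj.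
- by rewrite pairing_waction2 pairing_sroot scoroot_diag.
have [t_gt0|t_lt0|t_eq0] := ltrgtP 0 t; last by rewrite t_eq0 eqxx in t0.
  by exists (waction_dual A s (sroot R i)), t; split=> //; exists s, i.
exists (- waction_dual A s (sroot R i)), (- t); split; last by rewrite bE scaleNr.
  by apply: real_rootN; exists s, i.
by rewrite oppr_gt0.
Qed.

(** Finite roots vanish in coordinate 0 and [delta] does not, so this coordinate isolates the
    multiple of [delta]; integrality then excludes a rescaled simple root. *)
Lemma affine_refl_spacing (j : 'I_n) (m : R) :
  is_reflection A (affine_refl A (sroot R (fnode j)) (scoroot A (fnode j)) m) ->
  exists k : int, m = k%:~R * ratr (c (sroot R (fnode j))).
Proof.
have [_ H] := cP => /H [a [av [k [f e]]]].
have [x||t t0 [bE _]] := @rank_one_eq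
    (sroot R (fnode j) - m *: delta A) (a - (k%:~R * ratr (c a)) *: delta A)
    (scoroot A (fnode j)) av.
- by have := e x; rewrite !affine_reflE => /addrI/oppr_inj.
- by rewrite pairingBr pairingZr pairing_delta mulr0 subr0 pairing_sroot scoroot_diag.
have a00 := froot_coord0 f.1.
have mE : m = t * (k%:~R * ratr (c a)).
  have j0 : sroot R (fnode j) 0 ord0 = 0 by rewrite mxE.
  have := congr1 (pairing (sroot R ord0)) bE.
  rewrite !(pairingBr, pairingZr) !sroot_pairing a00 j0 !sub0r mulrN mulrA.
  by move=> /oppr_inj/(mulIf (lt0r_neq0 (delta_coord_gt0 ord0))).
have aE : a = t^-1 *: sroot R (fnode j).
  apply: (@scalerI _ _ t) => //; rewrite scalerA divff // scale1r.
  move: bE; rewrite mE scalerBr scalerA => /addIr ->//.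
have t1 : 0 <= t^-1 by have := f.2 (fnode j); rewrite aE !mxE !eqxx mulr1.
have aj := real_root_multiple (froot_real f.1) aE t1.
have tE : t = 1.
  move/(congr1 (fun v : h => v 0 (fnode j))): aE; rewrite aj !mxE !eqxx mulr1.
  by move/(congr1 (fun z => z^-1)); rewrite invrK invr1.
by exists k; rewrite mE tE mul1r aj.
Qed.

Lemma regular_two_rho : regular_point A (two_rho A).
Proof.
move=> s i; rewrite -[s]revK waction_rev_coord.
have [a [av [k [t [f t0 ->]]]]] := real_root_hyperplane (rev s) i.
rewrite pairingZr pairingBr pairingZr (two_rho_h0 thetaP) mulr0 subr0 mulf_neq0 //.
by apply: (froot_pairing_neq0 _ f.1) => j; rewrite (two_rho_coord thetaP).
Qed.

Lemma pos_froot_two_rho a av : pos_froot A a av -> 0 < pairing (two_rho A) a.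
Proof.
by apply: pos_froot_pairing_gt0 => j; rewrite (two_rho_coord thetaP).
Qed.

Variables (l : R) (l_gt0 : 0 < l).

Lemma fund_alcove_nonempty : exists p, fund_alcove A l p.
Proof.
have m0 : 0 < \sum_i delta A 0 i.
  by rewrite (bigD1 ord0) //= ltr_pwDl ?delta_coord_gt0 ?sumr_ge0 // => i _;
    rewrite ltW ?delta_coord_gt0.
exists (const_mx (l / \sum_i delta A 0 i)); split=> [|i].
  rewrite /pairing; under eq_bigr do rewrite mxE.
  by rewrite -mulr_sumr divfK // gt_eqF.
by rewrite pairing_sroot mxE divr_gt0.
Qed.

(** The hyperplane crossed by the step is the only one separating the two alcoves, so its root,
    pulled back by [s], is alpha_i up to a scalar. At the level 0 point [two_rho] the [delta] part
    disappears and the sign of that scalar remains. *)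
Lemma positive_stepP s i :
  positive_step A c l s i <-> waction A (rev s) (two_rho A) 0 i < 0.
Proof.
have r0 := two_rho_h0 thetaP.
rewrite waction_rev_coord; split=> [[a [av [k /= [f H1 H2]]]]|neg].
- have [p [pl p0]] := fund_alcove_nonempty.
  have [y [t [ry t0 yE]]] := hyperplane_real_root k f.
  have sp : alcove A l s (waction A s p) by exists p.
  have ssp : alcove A l (rcons s i) (waction A s (srefl A i p)).
    by exists p => //; rewrite waction_rcons.
  have py x : pairing x (delta A) = l -> pairing x y =
      t * (pairing x a - l * (k%:~R * ratr (c a))).
    by move=> xl; rewrite yE pairingZr pairingBr pairingZr xl [l * _]mulrC.
  have y' : - waction_dual A (rev s) y = sroot R i.
    apply: (@real_root_separation _ _ _ _ i p) => [j|||].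
    + by rewrite -pairing_sroot.
    + exact/real_rootN/real_root_waction.
    + rewrite pairingNr -pairing_waction oppr_gt0 py ?waction_delta //.
      by rewrite pmulr_rlt0 // subr_lt0; apply: H1.
    + rewrite pairingNr -pairing_waction oppr_lt0 py; last first.
        by rewrite waction_delta srefl_delta.
      by rewrite pmulr_rgt0 // subr_gt0; apply: H2.
  rewrite -y' linearN /= waction_dualVK pairingNr oppr_lt0 yE pairingZr pairingBr.
  by rewrite pairingZr r0 mulr0 subr0 mulr_gt0 // (pos_froot_two_rho f).
have [a [av [k [t [f t0 E]]]]] := real_root_hyperplane s i.
have rE : pairing (two_rho A) (waction_dual A s (sroot R i)) = t * pairing (two_rho A) a.
  by rewrite E pairingZr pairingBr pairingZr r0 mulr0 subr0.
have t_lt0 : t < 0 by rewrite rE pmulr_llt0 ?(pos_froot_two_rho f) in neg.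
have px x : pairing x (delta A) = l -> pairing (waction A (rev s) x) (sroot R i) =
    t * (pairing x a - l * (k%:~R * ratr (c a))).
  move=> xl; rewrite -pairing_waction_dual E pairingZr pairingBr pairingZr xl.
  by rewrite [l * _]mulrC.
exists a, av, k; split=> // x [y [yl y0] <-].
  have := y0 i; rewrite -{1}[y](wactionK A s) px ?waction_delta //.
  by rewrite nmulr_rgt0 // subr_lt0.
have := y0 i; rewrite pairing_sroot -oppr_lt0 -(srefl_coord A) -pairing_sroot.
rewrite -{1}[srefl A i y](wactionK A s) -waction_rcons px ?waction_delta //.
by rewrite nmulr_rlt0 // subr_gt0.
Qed.

End Hyperplanes.

(** * Translations and the semidirect decomposition *)

Section Translations.
Variables (R : realType) (n : nat) (A : affine_cartan R n).
Local Notation I := 'I_n.+1.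
Local Notation h := 'rV[R]_n.+1.
Implicit Types (x y a av : h) (i : I) (j : 'I_n) (s u v : seq I) (la mu nu : 'rV[int]_n).
Variables (theta : 'rV[int]_n) (thetaP : highest_coroot A theta).
Variables (c : h -> rat) (cP : reflection_spacing A c).

Local Notation fin := (map (@fnode n)).

Definition translation_vec la : h :=
  \sum_j (ratr (c (sroot R (fnode j))) * (la 0 j)%:~R) *: scoroot A (fnode j).

Lemma translationE la x :
  translation A c la x = x + pairing x (delta A) *: translation_vec la.
Proof. by []. Qed.

Lemma translation_vec_is_zmod_morphism : zmod_morphism translation_vec.
Proof.
move=> la mu; rewrite /translation_vec -sumrB; apply: eq_bigr => i _.
by rewrite !mxE rmorphB mulrBr scalerBl.
Qed.

HB.instance Definition _ := GRing.isZmodMorphism.Build 'rV[int]_n h translation_vec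
  translation_vec_is_zmod_morphism.

Lemma translation_vec_delta j (k : int) : translation_vec (k *: delta_mx 0 j) =
  (k%:~R * ratr (c (sroot R (fnode j)))) *: scoroot A (fnode j).
Proof.
rewrite /translation_vec (bigD1 j) //= big1 => [|i /negPf ij]; rewrite !mxE ?eqxx ?ij.
  by rewrite mulr1 addr0 mulrC.
by rewrite !mulr0 scale0r.
Qed.

Lemma translation_vec_level0 la : pairing (translation_vec la) (delta A) = 0.
Proof.
rewrite /translation_vec; elim/big_rec: _ => [|j x _ IH].
  by rewrite -[0](subrr 0) pairingBl subrr.
by rewrite pairingDl IH addr0 pairingZl pairing_delta mulr0.
Qed.

Lemma translation_level la x :
  pairing (translation A c la x) (delta A) = pairing x (delta A).
Proof. by rewrite translationE pairingDl pairingZl translation_vec_level0 mulr0 addr0. Qed.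

Lemma translation0 x : translation A c 0 x = x.
Proof. by rewrite translationE raddf0 scaler0 addr0. Qed.

Lemma translationD la mu x :
  translation A c (la + mu) x = translation A c la (translation A c mu x).
Proof.
rewrite translationE [in RHS]translationE translation_level translationE.
by rewrite raddfD scalerDr /= [_ *: _ + _]addrC addrA.
Qed.

Lemma translation_fixed la x : pairing x (delta A) = 0 -> translation A c la x = x.
Proof. by move=> x0; rewrite translationE x0 scale0r addr0. Qed.

Lemma translation_walkN la s : waction A s =1 translation A c la ->
  waction A (rev s) =1 translation A c (- la).
Proof.
move=> e x; apply: (can_inj (wactionK A s)).
by rewrite wactionVK e -translationD subrr translation0.
Qed.

Lemma translation_walkD la mu s u : waction A s =1 translation A c la ->
  waction A u =1 translation A c mu ->
  waction A (s ++ u) =1 translation A c (la + mu).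
Proof. by move=> es eu x; rewrite waction_cat eu es -translationD. Qed.

Lemma translation_walk_exists la : exists s, waction A s =1 translation A c la.
Proof.
elim/lattice_ind: la => [|la mu [s es] [u eu]|la [s es]|j].
- by exists [::] => x; rewrite translation0.
- by exists (s ++ u); apply: translation_walkD.
- by exists (rev s); apply: translation_walkN.
have simple : exists s, waction A s =1 translation A c (1 *: delta_mx 0 j).
  (* A simple translation is the product of the reflections in two consecutive parallel hyperplanes,
     the second one passing through the origin. *)
  have [s [i e]] : is_reflection A (affine_refl A (sroot R (fnode j))
      (scoroot A (fnode j)) (1%:~R * ratr (c (sroot R (fnode j))))).
    have [_ H] := cP; apply/H; exists (sroot R (fnode j)), (scoroot A (fnode j)), 1.
    by split=> //; apply: pos_froot_simple.
  exists ((s ++ i :: rev s) ++ [:: fnode j]) => x.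
  rewrite waction_cat -e affine_reflE /= translationE translation_vec_delta.
  rewrite pairingBr pairingZr pairing_sroot srefl_coord srefl_delta scalerA.
  rewrite sreflE; apply/rowP => k; rewrite !mxE; ring.
by rewrite scale1r in simple.
Qed.

(** Conjugating [s_j] by a translation gives a reflection of [W] in a parallel hyperplane, whose
    offset must respect the spacing. *)
Lemma translation_spacing la j : exists k : int,
  pairing (translation_vec la) (sroot R (fnode j)) = k%:~R * ratr (c (sroot R (fnode j))).
Proof.
have [s e] := translation_walk_exists la.
apply: (affine_refl_spacing cP); exists s, (fnode j) => x.
rewrite waction_reflection e translation_fixed ?pairing_delta // affine_reflE; congr (_ - _ *: _).
rewrite pairing_waction_dual (translation_walkN e) translationE raddfN /=.
by rewrite pairingDl pairingBr !pairingZl !pairingZr pairingNl mulrN mulrC.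
Qed.

Lemma srefl_translation_vec j la : exists mu,
  srefl A (fnode j) (translation_vec la) = translation_vec mu.
Proof.
have [k e] := translation_spacing la j.
exists (la - k *: delta_mx 0 j).
by rewrite raddfB /= translation_vec_delta -e.
Qed.

Lemma waction_translation_vec (u : seq 'I_n) la : exists mu,
  waction A (fin u) (translation_vec la) = translation_vec mu.
Proof.
elim: u => [|j u [mu IH]]; first by exists la.
by have [nu e] := srefl_translation_vec j mu; exists nu; rewrite -e -IH.
Qed.

Lemma waction_translation (u : seq 'I_n) la : exists mu, forall x,
  waction A (fin u) (translation A c la x) = translation A c mu (waction A (fin u) x).
Proof.
have [mu e] := waction_translation_vec u la; exists mu => x.
by rewrite !translationE linearD linearZ /= e waction_delta.
Qed.

(** [s_0] is an affine reflection along a finite root. Conjugation by a finite element makes that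
    root simple, which shows that the offset is a multiple of the spacing of a simple root, hence
    that the translation part lies in the lattice. *)
Lemma srefl0_decomposition : exists mu (u : seq 'I_n), forall x,
  srefl A ord0 x = translation A c mu (waction A (fin u) x).
Proof.
have [a [av [k [[f a0] e]]]] : exists a av (k : int), pos_froot A a av /\
    waction A [:: ord0] =1 affine_refl A a av (k%:~R * ratr (c a)).
  by have [_ H] := cP; apply/H; exists [::], ord0.
set m := k%:~R * _ in e; have [v vE] := froot_reflection f.
have sE x : srefl A ord0 x = waction A (fin v) x + (m * pairing x (delta A)) *: av.
  rewrite -[LHS]/(waction A [:: ord0] x) e affine_reflE pairingBr pairingZr scalerBl.
  by rewrite vE opprB addrA addrAC.
have [u [j [aE avE]]] := f.
have [k' mk'] : exists k' : int, m = k'%:~R * ratr (c (sroot R (fnode j))).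
  apply: (affine_refl_spacing cP); exists (rev (fin u)), ord0 => x.
  rewrite revK waction_cat /= -[srefl A ord0 _]/(waction A [:: ord0] _) e !affine_reflE.
  rewrite [RHS]linearB [X in _ = _ - X]linearZ /= (wactionK A (fin u) x) avE wactionK aE.
  congr (_ - _ *: _).
  rewrite !pairingBr !pairingZr waction_delta; congr (_ - _).
  by rewrite pairing_waction2.
have [mu muE] := waction_translation_vec u (k' *: delta_mx 0 j).
exists mu, v => x; rewrite sE translationE -muE translation_vec_delta -mk'.
by rewrite linearZ /= -avE waction_delta scalerA mulrC.
Qed.

Lemma waction_decomposition s : exists la (u : seq 'I_n), forall x,
  waction A s x = translation A c la (waction A (fin u) x).
Proof.
elim: s => [|i s [la [u IH]]]; first by exists 0, [::] => x; rewrite translation0.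
case: (unliftP ord0 i) => [j ->|->].
  have [mu e] := waction_translation [:: j] la.
  by exists mu, (j :: u) => x; rewrite /= IH -e.
have [mu [v e]] := srefl0_decomposition.
have [nu e'] := waction_translation v la.
exists (mu + nu), (v ++ u) => x.
by rewrite /= IH e e' translationD map_cat waction_cat.
Qed.

Hypothesis labelA : special_labelling A.

Lemma eq_cl s s' : (forall x, pairing x (delta A) = 0 -> waction A s x = waction A s' x) ->
  cl A s = cl A s'.
Proof.
move=> e; apply/lfunP => x; apply: val_inj; rewrite -![\val _]/(vsval _) !clE.
by apply: e; apply/eqP; rewrite -mem_h0; apply: subvsP.
Qed.

(** The kernel of [cl] consists of translations: the finite parts have equal images under [cl],
    hence equal actions on the whole of [h] by the choice of labelling. *)
Lemma cl_eq s s' : cl A s = cl A s' ->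
  exists la, forall x, waction A s x = translation A c la (waction A s' x).
Proof.
move=> e; have [la [u uE]] := waction_decomposition s.
have [mu [v vE]] := waction_decomposition s'.
have clu t w mu' : (forall x, waction A t x = translation A c mu' (waction A (fin w) x)) ->
    cl A t = cl A (fin w).
  move=> tE; apply: eq_cl => x x0.
  by rewrite tE translation_fixed // waction_delta.
have euv := labelA.1 u v; rewrite -(clu _ _ _ uE) -(clu _ _ _ vE) in euv.
exists (la - mu) => x; rewrite uE vE -translationD subrK.
by rewrite (euv e).
Qed.

End Translations.

(** * Number of hyperplanes crossed by a walk *)

Section Floor.
Variables (R : realType) (y1 y2 : R).
Hypotheses (y1_nint : forall k : int, y1 != k%:~R) (y2_nint : forall k : int, y2 != k%:~R).

Lemma floor_eq_nseparated :
  (forall k : int, y1 < k%:~R -> ~ k%:~R < y2) ->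
  (forall k : int, y2 < k%:~R -> ~ k%:~R < y1) -> Num.floor y1 = Num.floor y2.
Proof.
move=> H1 H2; apply/eqP; rewrite eq_le !floor_ge_int !leNgt.
apply/andP; split; apply/negP => lt.
- by apply: (H2 _ lt); rewrite lt_neqAle eq_sym y1_nint floor_le.
- by apply: (H1 _ lt); rewrite lt_neqAle eq_sym y2_nint floor_le.
Qed.

Lemma floor_separated (k : int) : y2 < k%:~R < y1 ->
  (forall k' : int, y2 < k'%:~R < y1 -> k' = k) ->
  Num.floor y1 = k /\ Num.floor y2 = k - 1.
Proof.
move=> /andP[lt2 lt1] uniq; split.
- apply/eqP; rewrite eq_le floor_ge_int (ltW lt1) andbT -ltzD1 floor_lt_int ltNge.
  apply/negP => le; suff : k + 1 = k by lia.
  apply: uniq; apply/andP; split.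
    by rewrite (lt_trans lt2) // ltr_int; lia.
  by rewrite lt_neqAle eq_sym y1_nint.
- apply/eqP; rewrite eq_le -ltzD1 subrK floor_lt_int lt2 floor_ge_int leNgt.
  apply/negP => lt; suff : k - 1 = k by lia.
  by apply: uniq; rewrite lt (lt_trans _ lt1) // ltr_int; lia.
Qed.

End Floor.

Section Crossing.
Variables (R : realType) (n : nat) (A : affine_cartan R n).
Local Notation I := 'I_n.+1.
Local Notation h := 'rV[R]_n.+1.
Implicit Types (x y a av : h) (j : I) (i : 'I_n) (s u v : seq I) (la mu nu : 'rV[int]_n).
Variables (theta : 'rV[int]_n) (thetaP : highest_coroot A theta).
Variables (c : h -> rat) (cP : reflection_spacing A c).

Local Notation r := (two_rho A).

Definition step_sign (b : bool) : int := if b then 1 else -1.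

Definition crossing x s : int :=
  signed_walk A (+%R : Monoid.law (0 : int)) (fun=> 1) (fun=> -1) x s.

Lemma crossing_cat x s s' :
  crossing x (s ++ s') = crossing x s + crossing (waction A (rev s) x) s'.
Proof. exact: signed_walk_cat. Qed.

Lemma crossing_rcons x s j : crossing x (rcons s j) =
  crossing x s + step_sign (waction A (rev s) x 0 j < 0).
Proof. exact: signed_walk_rcons. Qed.

Lemma eq_crossing x s s' : regular_point A x -> waction A s =1 waction A s' ->
  crossing x s = crossing x s'.
Proof. by apply: eq_signed_walk => *; rewrite ?subrr ?addNr. Qed.

Lemma crossing_rev x s : regular_point A x -> waction A (rev s) x = x ->
  crossing x (rev s) = - crossing x s.
Proof.
move=> rx sx; apply/eqP; rewrite -addr_eq0 addrC -{2}sx -crossing_cat.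
by rewrite /crossing signed_walk_catrev // => *; rewrite ?subrr ?addNr.
Qed.

Lemma spacing_gt0 i : 0 < ratr (c (sroot R (fnode i))) :> R.
Proof. by rewrite ltr0q; apply: cP.1 (pos_froot_simple A i). Qed.

Variables (i : 'I_n) (p : h) (p_gt0 : forall j, 0 < p 0 j).
Local Notation ci := (ratr (c (sroot R (fnode i))) : R).
Local Notation l := (pairing p (delta A)).

(** Normalised so that, at level [l], the hyperplanes parallel to that of alpha_i are the integral
    values. *)
Definition level_coord x : R := pairing x (sroot R (fnode i)) / (l * ci).

Lemma level_gt0 : 0 < l.
Proof.
rewrite /pairing big_ord_recl ltr_pwDl ?mulr_gt0 ?delta_coord_gt0 ?sumr_ge0 //.
by move=> j _; rewrite mulr_ge0 // ltW ?delta_coord_gt0.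
Qed.

Lemma level_coord_hyperplane (k : int) : exists2 y, real_root A y &
  exists2 t : R, 0 < t & y = t *: (sroot R (fnode i) - (k%:~R * ci) *: delta A) /\
  forall x, pairing x (delta A) = l -> pairing x y = t * (l * ci) * (level_coord x - k%:~R).
Proof.
have [y [t [ry t0 yE]]] := hyperplane_real_root cP k (pos_froot_simple A i).
exists y => //; exists t => //; split=> // x xl.
rewrite yE pairingZr pairingBr pairingZr xl /level_coord; field.
by rewrite !gt_eqF ?spacing_gt0 ?level_gt0.
Qed.

Lemma level_coord_nint s (k : int) : level_coord (waction A s p) != k%:~R.
Proof.
have [y ry [t t0 [_ yE]]] := level_coord_hyperplane k.
have := pairing_real_root_neq0 p_gt0 (real_root_waction (rev s) ry).
rewrite -pairing_waction yE ?waction_delta //.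
by rewrite mulf_eq0 negb_or subr_eq0 => /andP[].
Qed.

Lemma level_coord_separated s j (k : int) a av (k' : int) (t : R) :
  pos_froot A a av ->
  waction_dual A s (sroot R j) = t *: (a - (k'%:~R * ratr (c a)) *: delta A) ->
  (level_coord (waction A s p) < k%:~R < level_coord (waction A (rcons s j) p)) ||
  (level_coord (waction A (rcons s j) p) < k%:~R < level_coord (waction A s p)) ->
  a = sroot R (fnode i) /\ k = k'.
Proof.
move=> f sj sep.
have [y ry [u u0 [yE py]]] := level_coord_hyperplane k.
have ul : 0 < u * (l * ci) by rewrite mulr_gt0 // mulr_gt0 ?spacing_gt0 ?level_gt0.
have ysj : exists2 w : R, w != 0 & y = w *: waction_dual A s (sroot R j).
  have rry := real_root_waction (rev s) ry.
  have p1 : pairing p (waction_dual A (rev s) y) =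
      u * (l * ci) * (level_coord (waction A s p) - k%:~R).
    by rewrite -pairing_waction py ?waction_delta.
  have p2 : pairing (srefl A j p) (waction_dual A (rev s) y) =
      u * (l * ci) * (level_coord (waction A (rcons s j) p) - k%:~R).
    by rewrite -pairing_waction -waction_rcons py ?waction_delta.
  case/orP: sep => /andP[lt1 lt2].
  - exists (-1); first by rewrite oppr_eq0 oner_eq0.
    rewrite -(real_root_separation p_gt0 (real_rootN rry) (j := j)).
    + by rewrite linearN /= waction_dualVK scaleN1r opprK.
    + by rewrite pairingNr p1 oppr_gt0 pmulr_rlt0 // subr_lt0.
    + by rewrite pairingNr p2 oppr_lt0 pmulr_rgt0 // subr_gt0.
  - exists 1; first by rewrite oner_eq0.
    rewrite -(real_root_separation p_gt0 rry (j := j)).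
    + by rewrite waction_dualVK scale1r.
    + by rewrite p1 pmulr_rgt0 // subr_gt0.
    + by rewrite p2 pmulr_rlt0 // subr_lt0.
have [w w0 ye] := ysj; rewrite yE sj scalerA in ye.
set v := w * t in ye.
have a00 := froot_coord0 f.1.
have i0 : sroot R (fnode i) 0 ord0 = 0 by rewrite mxE.
have e0 : u * (k%:~R * ci) = v * (k'%:~R * ratr (c a)).
  have := congr1 (pairing (sroot R ord0)) ye.
  rewrite !(pairingBr, pairingZr) !sroot_pairing a00 i0 !sub0r !mulrN !mulrA.
  by move=> /oppr_inj/(mulIf (lt0r_neq0 (delta_coord_gt0 A ord0))).
have e1 : u *: sroot R (fnode i) = v *: a.
  by move: ye; rewrite !scalerBr !scalerA e0 => /addIr.
have v0 : 0 < v.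
  have := congr1 (fun z : h => z 0 (fnode i)) e1; rewrite !mxE !eqxx mulr1 => e2.
  have := f.2 (fnode i); rewrite le_eqVlt => /orP[/eqP a0|a0].
    by move: u0; rewrite e2 -a0 mulr0 ltxx.
  by rewrite -(pmulr_lgt0 _ a0) -e2.
have aE : a = (v^-1 * u) *: sroot R (fnode i).
  by rewrite -scalerA e1 scalerA mulVf ?scale1r // gt_eqF.
have aj : a = sroot R (fnode i).
  by apply: real_root_multiple (froot_real f.1) aE _; rewrite mulr_ge0 ?invr_ge0 // ltW.
split=> //; have uv : u = v.
  have := congr1 (fun z : h => z 0 (fnode i)) e1; rewrite aj !mxE !eqxx !mulr1.
  by [].
move: e0; rewrite uv aj => /(mulfI (lt0r_neq0 v0)).
by move=> /(mulIf (lt0r_neq0 (spacing_gt0 i)))/intr_inj.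
Qed.

Lemma two_rho_srefl_gt0 a av : pos_froot A a av -> a <> sroot R (fnode i) ->
  0 < pairing (srefl A (fnode i) r) a.
Proof.
move=> f ai; rewrite pairing_srefl.
exact: (pos_froot_two_rho thetaP (pos_froot_srefl f ai)).
Qed.

(** Positive roots other than alpha_i stay positive under [s_i], so both signs agree unless the
    crossed wall is parallel to that of alpha_i; in that case they are opposite and the floor
    changes by one. *)
Lemma crossing_floor_step s j :
  step_sign (waction A (rev s) r 0 j < 0) -
  step_sign (waction A (rev s) (srefl A (fnode i) r) 0 j < 0) =
  2 * (Num.floor (level_coord (waction A (rcons s j) p)) -
       Num.floor (level_coord (waction A s p))).
Proof.
have [a [av [k [t [f t0 sj]]]]] := real_root_hyperplane cP s j.
have rd := two_rho_h0 thetaP.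
have sgn x : pairing x (delta A) = 0 -> waction A (rev s) x 0 j = t * pairing x a.
  by move=> x0; rewrite waction_rev_coord sj pairingZr pairingBr pairingZr x0 mulr0 subr0.
rewrite !sgn ?srefl_delta //.
have r_gt0 := pos_froot_two_rho thetaP f.
have nint1 := level_coord_nint s; have nint2 := level_coord_nint (rcons s j).
have sep := level_coord_separated f sj.
have [ai|ai] := pselect (a = sroot R (fnode i)); last first.
  rewrite (floor_eq_nseparated nint1 nint2); first last.
  - by move=> k' lt1 lt2; apply: ai; apply: (sep k' _).1; rewrite lt1 lt2 orbT.
  - by move=> k' lt1 lt2; apply: ai; apply: (sep k' _).1; rewrite lt1 lt2.
  rewrite subrr mulr0.
  by rewrite !pmulr_llt0 // ?subrr // (two_rho_srefl_gt0 f ai).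
rewrite ai pairing_srefl srefl_dual_sroot_diag pairingNr -ai.
have [y ry [u u0 [yE py]]] := level_coord_hyperplane k.
have ul : 0 < u * (l * ci) by rewrite mulr_gt0 // mulr_gt0 ?spacing_gt0 ?level_gt0.
have tE : waction_dual A (rev s) y = (t^-1 * u) *: sroot R j.
  rewrite -[sroot R j](waction_dualK A s) sj -linearZ /= scalerA.
  by rewrite mulrAC mulVf // mul1r ai -yE.
have p1 : u * (l * ci) * (level_coord (waction A s p) - k%:~R) = t^-1 * u * p 0 j.
  by rewrite -py ?waction_delta // pairing_waction tE pairingZr pairing_sroot.
have p2 : u * (l * ci) * (level_coord (waction A (rcons s j) p) - k%:~R) =
    - (t^-1 * u * p 0 j).
  rewrite -py ?waction_delta // waction_rcons pairing_waction tE pairingZr pairing_sroot.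
  by rewrite srefl_coord mulrN.
have up : 0 < u * p 0 j by rewrite mulr_gt0.
have [t_gt0|t_lt0|t_eq0] := ltrgtP 0 t; last by rewrite t_eq0 eqxx in t0.
- have [||fl1 fl2] := @floor_separated _ _ (level_coord (waction A (rcons s j) p)) nint1 k.
  + rewrite -[_ < level_coord _]subr_gt0 -[_ < k%:~R]subr_lt0.
    rewrite -(pmulr_rgt0 _ ul) p1 -mulrA pmulr_rgt0 ?invr_gt0 // up andbT.
    by rewrite -(pmulr_rlt0 _ ul) p2 oppr_lt0 -mulrA pmulr_rgt0 ?invr_gt0.
  + by move=> k' lt; apply: (sep k' _).2; rewrite lt orbT.
  rewrite fl1 fl2 ltNge mulr_ge0 ?(ltW t_gt0) ?(ltW r_gt0) //= mulrN oppr_lt0 mulr_gt0 //.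
  by rewrite /step_sign; lia.
- have [||fl1 fl2] := @floor_separated _ _ (level_coord (waction A s p)) nint2 k.
  + rewrite -[_ < level_coord _]subr_gt0 -[_ < k%:~R]subr_lt0.
    rewrite -(pmulr_rlt0 _ ul) p1 -mulrA nmulr_rlt0 ?invr_lt0 // up /=.
    by rewrite -(pmulr_rgt0 _ ul) p2 oppr_gt0 -mulrA nmulr_rlt0 ?invr_lt0.
  + by move=> k' lt; apply: (sep k' _).2; rewrite lt.
  rewrite fl1 fl2 nmulr_rlt0 // r_gt0 mulrN oppr_lt0 ltNge nmulr_rle0 // (ltW r_gt0) /=.
  by rewrite /step_sign; lia.
Qed.

Lemma crossing_floor s : crossing r s - crossing (srefl A (fnode i) r) s =
  2 * (Num.floor (level_coord (waction A s p)) - Num.floor (level_coord p)).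
Proof.
elim/last_ind: s => [|s j IH]; first by rewrite /crossing /= !subrr.
have := crossing_floor_step s j; rewrite !crossing_rcons; move: IH; lia.
Qed.

(** The counts from [r] and from [s_i r] are opposite, and by the floor formula they differ by 4,
    since the translation raises [level_coord] by [a_ii = 2]. *)
Lemma crossing_simple s :
  waction A s =1 translation A c (delta_mx 0 i) -> crossing r s = 2.
Proof.
move=> e; have rr := regular_two_rho thetaP cP.
have r0 := two_rho_h0 thetaP.
have eN := translation_walkN e.
have e_conj : waction A (rev s) =1 waction A (fnode i :: s ++ [:: fnode i]).
  move=> x /=; rewrite waction_cat eN e !translationE /= raddfN /=.
  have := translation_vec_delta A c i 1; rewrite scale1r => ->.
  rewrite [RHS]linearD /= [srefl A _ (_ *: _)]linearZ /=.
  rewrite [srefl A _ (_ *: _)]linearZ /= sreflK srefl_scoroot srefl_delta.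
  by rewrite !scalerN.
have sr : waction A (rev s) (srefl A (fnode i) r) = srefl A (fnode i) r.
  by rewrite eN translation_fixed // srefl_delta.
have ri : 0 < r 0 (fnode i) by rewrite (two_rho_coord thetaP).
(* The inverse translation is [s_i t s_i]; the two outer steps have opposite signs and cancel. *)
have E1 : crossing (srefl A (fnode i) r) s = - crossing r s.
  rewrite -crossing_rev //; last by rewrite eN translation_fixed.
  rewrite (eq_crossing rr e_conj) -cat1s !crossing_cat /= sr.
  rewrite /crossing /= srefl_coord oppr_lt0 ri ltNge (ltW ri) /=.
  by rewrite !addr0; lia.
have := crossing_floor s; rewrite E1 opprK.
have -> : level_coord (waction A s p) = level_coord p + 2%:~R.
  rewrite e translationE; have := translation_vec_delta A c i 1; rewrite scale1r => ->.
  rewrite /level_coord pairingDl !pairingZl pairing_scoroot cartan_diag mul1r mulrDl.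
  congr (_ + _); rewrite mulrA mulrAC mulfV ?mul1r // gt_eqF // mulr_gt0 //.
    exact: level_gt0.
  exact: spacing_gt0.
rewrite floorDrz ?intr_int // intrKfloor.
by rewrite addrAC subrr add0r; lia.
Qed.

End Crossing.

Section CrossingTranslation.
Variables (R : realType) (n : nat) (A : affine_cartan R n).
Variables (theta : 'rV[int]_n) (thetaP : highest_coroot A theta).
Variables (c : 'rV[R]_n.+1 -> rat) (cP : reflection_spacing A c).

(** Translations fix the level 0 point [two_rho], so the count is additive on them. *)
Lemma crossing_translation la s : waction A s =1 translation A c la ->
  crossing A (two_rho A) s = 2 * height la.
Proof.
have rr := regular_two_rho thetaP cP.
have fixr mu u : waction A u =1 translation A c mu -> waction A (rev u) (two_rho A) = two_rho A.
  by move=> /translation_walkN ->; rewrite translation_fixed // (two_rho_h0 thetaP).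
elim/lattice_ind: la s => [|la mu IHla IHmu|la IH|j] s e.
- have e0 : waction A s =1 waction A [::] by move=> x; rewrite e translation0.
  by rewrite (eq_crossing rr e0) raddf0 mulr0.
- have [u eu] := translation_walk_exists cP la.
  have [v ev] := translation_walk_exists cP mu.
  have euv : waction A s =1 waction A (u ++ v).
    by move=> x; rewrite e (translation_walkD eu ev).
  rewrite (eq_crossing rr euv) crossing_cat (fixr _ _ eu) (IHla u) // (IHmu v) //.
  by rewrite raddfD mulrDr.
- have := translation_walkN e; rewrite opprK => /IH.
  by rewrite crossing_rev ?(fixr _ _ e) // raddfN mulrN => <-; rewrite opprK.
- have [p [_ p0]] := fund_alcove_nonempty A ltr01.
  have := height_delta j 1; rewrite scale1r => ->; rewrite mulr1.
  apply: (crossing_simple thetaP cP (p := p)) e => k.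
  by rewrite -pairing_sroot.
Qed.

End CrossingTranslation.

(** * Free algebra actions and the level 0 representation *)

Section LinearExtension.
Variables (C : comNzRingType) (K : choiceType) (V : lmodType C) (F : K -> V).

Definition malg_ext (u : malg K C) : V := \sum_(k <- msupp u) mcoeff k u *: F k.

Lemma malg_extE (d : {fset K}) u : (msupp u `<=` d)%fset ->
  malg_ext u = \sum_(k <- d) mcoeff k u *: F k.
Proof.
move=> ud; apply: big_fset_incl => // k _ ku.
by rewrite mcoeff_outdom // scale0r.
Qed.

Lemma malg_ext_is_linear : linear malg_ext.
Proof.
move=> a u v; pose d := (msupp (a *: u + v) `|` (msupp u `|` msupp v))%fset.
rewrite !(@malg_extE d) ?fsubsetUl //; last 2 first.
- by rewrite /d fsetUA fsubsetUr.
- by rewrite /d fsetUCA fsubsetUl.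
rewrite scaler_sumr -big_split; apply: eq_bigr => k _ /=.
by rewrite mcoeffD mcoeffZ scalerDl scalerA.
Qed.

HB.instance Definition _ := GRing.isLinear.Build C (malg K C) V *:%R malg_ext
  malg_ext_is_linear.

Lemma malg_extU k (a : C) : malg_ext (mkmalgU k a) = a *: F k.
Proof.
rewrite (@malg_extE [fset k]%fset); last exact: msuppU_le.
by rewrite big_seq_fset1 mcoeffUU.
Qed.

End LinearExtension.

Lemma malg_linear_eq (C : comNzRingType) (K : choiceType) (V : lmodType C)
    (f g : {linear malg K C -> V}) :
  (forall k, f (mkmalgU k 1) = g (mkmalgU k 1)) -> f =1 g.
Proof.
move=> e u; rewrite [u]monalgE !linear_sum; apply: eq_bigr => k _ /=.
have -> : mkmalgU k (mcoeff k u) = mcoeff k u *: mkmalgU k 1.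
  by apply/malgP => k'; rewrite mcoeffZ !mcoeffU mulr_natr mulrb; case: eqP.
by rewrite !linearZ /= e.
Qed.

Section FreeAction.
Variables (C : fieldType) (I : choiceType) (V : lmodType C).
Variable f : I -> {linear V -> V}.
Local Notation free := (free_alg C I).
Implicit Types (u : free) (v : V) (i : I) (s : seq I).

Definition word_act s v : V := foldl (fun v i => f i v) v s.

Lemma word_act_is_linear s : linear (word_act s).
Proof.
by rewrite /word_act => a v w; elim: s v w => //= i s IH v w; rewrite linearP IH.
Qed.

HB.instance Definition _ s := GRing.isLinear.Build C V V *:%R (word_act s)
  (word_act_is_linear s).

Lemma word_act_cat s s' v : word_act (s ++ s') v = word_act s' (word_act s v).
Proof. by rewrite /word_act foldl_cat. Qed.

Lemma word_act_rcons s i v : word_act (rcons s i) v = f i (word_act s v).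
Proof. by rewrite -cats1 word_act_cat. Qed.

Definition free_act v u : V := malg_ext (fun m : fmonom I => word_act m v) u.

HB.instance Definition _ v := GRing.Linear.copy (free_act v)
  (malg_ext (fun m : fmonom I => word_act m v) : free -> V).

Lemma free_act_monomial v (m : fmonom I) :
  free_act v (mkmalgU m 1 : free) = word_act m v.
Proof. by rewrite /free_act malg_extU scale1r. Qed.

Lemma free_act_gen v i : free_act v (free_gen C i) = f i v.
Proof. by rewrite free_act_monomial fmU. Qed.

Lemma free_act1 v : free_act v 1 = v.
Proof. by rewrite -[1]/(mkmalgU (fmone I) 1 : free) free_act_monomial fmoneE. Qed.

Lemma free_act_is_linear_l u : linear (free_act ^~ u).
Proof.
move=> a v w; rewrite /free_act /malg_ext scaler_sumr -big_split /=.
apply: eq_bigr => m _; rewrite linearP scalerDr !scalerA; congr (_ *: _ + _).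
by rewrite mulrC.
Qed.

Lemma free_actM v u u' : free_act v (u * u') = free_act (free_act v u) u'.
Proof.
pose g u : {linear free -> V} := (free_act v : {linear free -> V}).
have monoE (x : free) : x = \sum_(k <- msupp x) mcoeff k x *: (mkmalgU k 1 : free).
  rewrite {1}[x]monalgE; apply: eq_bigr => k _.
  by apply/malgP => k'; rewrite mcoeffZ !mcoeffU mulr_natr mulrb; case: eqP.
rewrite [u]monoE mulr_suml !linear_sum.
have lin_l := free_act_is_linear_l u'.
have H (L : seq (fmonom I)) (F : fmonom I -> V) :
    free_act (\sum_(k <- L) mcoeff k u *: F k) u' =
    \sum_(k <- L) mcoeff k u *: free_act (F k) u'.
  elim: L => [|k L IH]; last by rewrite !big_cons lin_l IH.
  by rewrite !big_nil; have := lin_l (-1) 0 0; rewrite scaler0 addr0 scaleN1r addNr.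
under [X in _ = free_act X _]eq_bigr do rewrite linearZ.
rewrite H; apply: eq_bigr => k _.
rewrite -scalerAl linearZ /= free_act_monomial; congr (_ *: _).
rewrite [u']monoE mulr_sumr !linear_sum; apply: eq_bigr => k' _.
rewrite -free_scalerAr !linearZ /=; congr (_ *: _).
rewrite malgM_def fgmulUU mulr1 !free_act_monomial fmM.
exact: word_act_cat.
Qed.

Lemma free_act_alternating v i j m :
  free_act v (alternating C i j m) = word_act (alt i j m) v.
Proof.
elim: m => [|m IH]; first by rewrite /alternating big_ord0 free_act1.
rewrite alt_rcons word_act_rcons -IH /alternating big_ord_recr free_actM.
by rewrite free_act_gen.
Qed.

Section Braid.
Variables (a b : C) (f_quadratic : forall i v, f i (f i v) = a *: f i v + b *: v).

(** From the quadratic relation alone, the kernel of the braid difference [B] is stable under [f i],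
    and by symmetry under [f j]. It then suffices to find one vector of the kernel in each dihedral
    coset. *)
Lemma word_act_braid_shift i j m v :
  let B w := word_act (alt i j m.+1) w - word_act (alt j i m.+1) w in
  B (f i v) = a *: B v - f (nxt i j m.+1) (B v).
Proof.
move=> B; rewrite {}/B; set y := nxt i j m.+1.
have e1 : word_act (alt i j m.+1) (f i v) =
    a *: word_act (alt i j m.+1) v + b *: word_act (alt j i m) v.
  by rewrite -[LHS]/(word_act (alt j i m) (f i (f i v))) f_quadratic linearD !linearZ.
have e2 : word_act (alt j i m.+1) (f i v) = f y (word_act (alt i j m.+1) v).
  by rewrite -word_act_rcons -alt_rcons.
have e3 : f y (word_act (alt j i m.+1) v) =
    a *: word_act (alt j i m.+1) v + b *: word_act (alt j i m) v.
  by rewrite alt_rcons -nxtS word_act_rcons f_quadratic.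
rewrite e1 e2 [f y (_ - _)]linearB e3 scalerBr opprB.
by rewrite !addrA subrK.
Qed.

End Braid.
End FreeAction.

Lemma linear_combination_linear (C : comNzRingType) (V : lmodType C) (p q a : C)
    (x y x' y' : V) :
  p *: (a *: x + y) - q *: (a *: x' + y') = a *: (p *: x - q *: x') + (p *: y - q *: y').
Proof.
by rewrite !scalerDr scalerN !scalerA (mulrC a p) (mulrC a q) opprD addrACA.
Qed.

(** * The level 0 operators on the basis of the group algebra *)

Section LevelZero.
Variables (R : realType) (n : nat) (A : affine_cartan R n).
Local Notation I := 'I_n.+1.
Local Notation h := 'rV[R]_n.+1.
Local Notation r := (two_rho A).
Implicit Types (s u : seq I) (i j : I).

Lemma in_W0_cl s : in_W0 (cl A s).
Proof. by apply/asboolP; exists s. Qed.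

Definition W0_of_word s : W0 A := Sub (cl A s) (in_W0_cl s).

Lemma W0_of_wordP (w : W0 A) : exists s, w = W0_of_word s.
Proof.
by case: w => g gW; have /asboolP[s gs] := gW; exists s; apply: val_inj.
Qed.

Lemma eq_W0_of_word s s' : cl A s = cl A s' -> W0_of_word s = W0_of_word s'.
Proof. by move=> e; apply: val_inj. Qed.

Lemma eq_waction_cl s s' : waction A s =1 waction A s' -> cl A s = cl A s'.
Proof. by move=> e; apply: eq_cl => x _; apply: e. Qed.

Lemma W0_mul_of_word s i : W0_mul (W0_of_word s) i = W0_of_word (rcons s i).
Proof. by apply: val_inj; rewrite /= -cats1 cl_cat. Qed.

Variables (theta : 'rV[int]_n) (thetaP : highest_coroot A theta).

Lemma cl_inv_rho s i :
  (0 < pairing (vsval ((cl A s)^-1%VF (rho A))) (sroot R i)) =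
  (0 < waction A (rev s) r 0 i).
Proof.
have -> : ((cl A s)^-1%VF (rho A)) = cl A (rev s) (rho A).
  have k0 : lker (cl A s) == 0%VS.
    apply/lker0P => x y e; apply: val_inj; rewrite -![\val _]/(vsval _).
    by apply: (can_inj (wactionK A s)); rewrite -!clE e.
  have -> : rho A = cl A s (cl A (rev s) (rho A)).
    apply: val_inj; rewrite -![\val _]/(vsval _) !clE wactionVK //.
  rewrite lker0_lfunK //; congr (cl A _ _).
  by apply: val_inj; rewrite -![\val _]/(vsval _) !clE wactionVK.
rewrite clE (rhoE thetaP) linearZ /= pairingZl pairing_sroot pmulr_rgt0 //.
by rewrite invr_gt0.
Qed.

Variables (q1 q2 : R[i]) (q1_neq0 : q1 != 0) (q2_neq0 : q2 != 0).
Local Notation C := R[i].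

Definition word_basis s : CW0 A := mkmalgU (W0_of_word s) 1.

Lemma eq_word_basis s s' : cl A s = cl A s' -> word_basis s = word_basis s'.
Proof. by move=> e; rewrite /word_basis (eq_W0_of_word e). Qed.

Lemma word_basis_linear_eq (V : lmodType C) (f g : {linear CW0 A -> V}) :
  (forall s, f (word_basis s) = g (word_basis s)) -> f =1 g.
Proof. move=> e; apply: malg_linear_eq => w; have [s ->] := W0_of_wordP w; exact: e. Qed.

Lemma level0_T_is_linear i : linear (@level0_T R n A q1 q2 i).
Proof.
move=> a v w; rewrite /level0_T.
have e (f : W0 A -> W0 A) : lin_ext f (a *: v + w) = a *: lin_ext f v + lin_ext f w.
  exact: (malg_ext_is_linear (fun w => mkmalgU (f w) 1 : CW0 A)).
rewrite /level0_pi /level0_s !e.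
exact: linear_combination_linear.
Qed.

HB.instance Definition _ i := GRing.isLinear.Build C (CW0 A) (CW0 A) *:%R
  (@level0_T R n A q1 q2 i) (level0_T_is_linear i).

Lemma lin_ext_basis (f : W0 A -> W0 A) s :
  lin_ext f (word_basis s) = mkmalgU (f (W0_of_word s)) 1 :> CW0 A.
Proof.
transitivity (1 *: (mkmalgU (f (W0_of_word s)) 1 : CW0 A)); last exact: scale1r.
exact: (malg_extU (fun w => mkmalgU (f w) 1 : CW0 A)).
Qed.

Lemma scale_cancel (V : lmodType C) (p q : C) (x : V) : (p + q) *: x - p *: x = q *: x.
Proof. by rewrite scalerDl addrAC subrr add0r. Qed.

Lemma level0_T_basis s i : level0_T q1 q2 i (word_basis s) =
  if 0 < waction A (rev s) r 0 i then q2 *: word_basis (rcons s i)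
  else (q1 + q2) *: word_basis s - q1 *: word_basis (rcons s i).
Proof.
rewrite /level0_T /level0_pi /level0_s !lin_ext_basis cl_inv_rho W0_mul_of_word.
by case: (0 < _) => //; apply: scale_cancel.
Qed.

End LevelZero.

(** * Quadratic and braid relations at level 0 *)

Section AbstractLevelZero.
Variables (R : realType) (n : nat) (A : affine_cartan R n).
Local Notation I := 'I_n.+1.
Local Notation h := 'rV[R]_n.+1.
Implicit Types (s u : seq I) (i j : I).
Variables (r : h) (regular_r : regular_point A r).
Variables (C : fieldType) (q1 q2 : C) (q1_neq0 : q1 != 0) (q2_neq0 : q2 != 0).
Variables (V : lmodType C) (word_basis : seq I -> V) (f : I -> {linear V -> V}).
Hypothesis eq_waction_basis : forall s s', waction A s =1 waction A s' ->
  word_basis s = word_basis s'.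
Hypothesis word_basis_linear_eq : forall g g' : {linear V -> V},
  (forall s, g (word_basis s) = g' (word_basis s)) -> g =1 g'.
Hypothesis level0_T_basis : forall s i, f i (word_basis s) =
  if 0 < waction A (rev s) r 0 i then q2 *: word_basis (rcons s i)
  else (q1 + q2) *: word_basis s - q1 *: word_basis (rcons s i).

Lemma coord_rcons s i :
  waction A (rev (rcons s i)) r 0 i = - waction A (rev s) r 0 i.
Proof. by rewrite rev_rcons srefl_coord. Qed.

Lemma word_basis_rcons2 s i : word_basis (rcons (rcons s i) i) = word_basis s.
Proof.
by apply/eq_waction_basis => x; rewrite !waction_rcons sreflK.
Qed.

Lemma level0_T_quadratic i v :
  f i (f i v) = (q1 + q2) *: f i v + (- (q1 * q2)) *: v.
Proof.
pose g : {linear V -> V} := (f i \o f i)%FUN.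
pose g' : {linear V -> V} :=
  ((q1 + q2) \*: f i \+ (- (q1 * q2)) \*: idfun)%R.
apply: (word_basis_linear_eq (g := g) (g' := g')) => s; rewrite /g /g' /=.
rewrite !level0_T_basis; case: ifP => pos.
  rewrite linearZ level0_T_basis coord_rcons oppr_gt0 ltNge (ltW pos) /=.
  rewrite word_basis_rcons2 scalerBr !scalerA [q2 * _]mulrC [q2 * q1]mulrC.
  by rewrite scaleNr.
have neg : 0 < waction A (rev (rcons s i)) r 0 i.
  have := regular_r (rev s) i; rewrite coord_rcons oppr_gt0.
  by case: ltgtP pos.
rewrite [f i _]linearB ![f i (_ *: _)]linearZ /= !level0_T_basis pos neg word_basis_rcons2.
by rewrite !scalerA scaleNr.
Qed.

Lemma level0_alt s i j k :
  (forall k', (k' < k)%N -> 0 < pairing (waction A (rev s) r) (alt_root A i j k')) ->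
  word_act f (alt i j k) (word_basis s) =
  q2 ^+ k *: word_basis (s ++ alt i j k).
Proof.
elim: k => [|k IH] pos; first by rewrite cats0 expr0 scale1r.
rewrite alt_rcons word_act_rcons IH => [|k' k'k]; last by apply: pos; rewrite ltnW.
rewrite linearZ /= level0_T_basis rev_cat waction_cat alt_coord pos // scalerA.
by rewrite -rcons_cat exprSr.
Qed.

(** At the dominant element of a dihedral coset both sides act by the same power of [q2] and reach
    the same basis vector, so [B] vanishes there; the stability of the kernel of [B] propagates this
    over the coset. *)
Lemma level0_braid i j m v : coxeter_order A i j m ->
  word_act f (alt i j m) v = word_act f (alt j i m) v.
Proof.
move=> o; have := coxeter_order_gt0 o; case: m o => // m o _.
apply: (word_basis_linear_eq (g := word_act f (alt i j m.+1))
  (g' := word_act f (alt j i m.+1))) => s; apply/eqP.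
rewrite -subr_eq0; apply/eqP.
set B := fun v : V => word_act f (alt i j m.+1) v -
  word_act f (alt j i m.+1) v.
have Blin a b x y : B (a *: x + b *: y) = a *: B x + b *: B y.
  pose g : {linear V -> V} := (word_act f (alt i j m.+1) \- word_act f (alt j i m.+1))%R.
  by rewrite -[B _]/(g _) linearD !linearZ.
have Bshift k w : k \in [:: i; j] -> B w = 0 -> B (f k w) = 0.
  rewrite !inE => /orP[] /eqP -> Bw.
    have : B (f i w) = (q1 + q2) *: B w - f (nxt i j m.+1) (B w).
      exact: (word_act_braid_shift level0_T_quadratic).
    by rewrite Bw scaler0 linear0 subr0.
  have Bji x : - B x = word_act f (alt j i m.+1) x - word_act f (alt i j m.+1) x.
    by rewrite opprB.
  have : - B (f j w) = (q1 + q2) *: - B w - f (nxt j i m.+1) (- B w).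
    by rewrite !Bji; apply: (word_act_braid_shift level0_T_quadratic).
  by rewrite Bw oppr0 scaler0 linear0 subr0 => /eqP; rewrite oppr_eq0 => /eqP.
(* As [q1] and [q2] are invertible, the neighbouring basis vector is a combination of [f k] of the
   current one and the current one itself. *)
have Bstep u k : k \in [:: i; j] -> B (word_basis u) = 0 -> B (word_basis (rcons u k)) = 0.
  move=> kij Bu; have Bk := Bshift k _ kij Bu.
  have := level0_T_basis u k; case: ifP => _ e.
    have -> : word_basis (rcons u k) = q2^-1 *: f k (word_basis u) + 0 *: word_basis u.
      by rewrite e scalerA mulVf // scale1r scale0r addr0.
    by rewrite Blin Bk Bu !scaler0 addr0.
  have -> : word_basis (rcons u k) =
      (- q1^-1) *: f k (word_basis u) + (q1^-1 * (q1 + q2)) *: word_basis u.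
    rewrite e scalerBr !scalerA !mulNr scaleNr scaleNr opprK mulVf // scale1r.
    by rewrite addrAC addNr add0r.
  by rewrite Blin Bk Bu !scaler0 addr0.
(* Taking the opposite point turns the antidominant element into the dominant one. *)
have rx : regular_point A (- waction A (rev s) r).
  by move=> u k; rewrite linearN mxE oppr_eq0 /= -waction_cat.
have [cc [sub ci cj]] := dihedral_antidominant rx o.
have dom k : waction A cc (- waction A (rev s) r) 0 k < 0 ->
    0 < waction A (rev (s ++ rev cc)) r 0 k.
  by rewrite linearN mxE oppr_lt0 rev_cat revK waction_cat.
move/dom in ci; move/dom in cj.
have pos i' j' : coxeter_order A i' j' m.+1 ->
  0 < waction A (rev (s ++ rev cc)) r 0 i' -> 0 < waction A (rev (s ++ rev cc)) r 0 j' ->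
  forall k, (k < m.+1)%N -> 0 < pairing (waction A (rev (s ++ rev cc)) r) (alt_root A i' j' k).
  move=> {}o {}ci {}cj k km; rewrite lt_neqAle eq_sym -{1}alt_coord -waction_cat.
  rewrite regular_r /=.
  have [a [b [a0 b0 ->]]] := alt_root_nneg o km.
  rewrite pairingDr !pairingZr !pairing_sroot; nra.
have B0 : B (word_basis (s ++ rev cc)) = 0.
  rewrite /B (level0_alt (pos i j o ci cj)).
  rewrite (level0_alt (pos j i (coxeter_order_sym o) cj ci)).
  rewrite (@eq_waction_basis ((s ++ rev cc) ++ alt i j m.+1) ((s ++ rev cc) ++ alt j i m.+1)).
    by rewrite subrr.
  by move=> x; rewrite !(waction_cat _ (s ++ rev cc)) (waction_braid o).
have -> : word_basis s = word_basis ((s ++ rev cc) ++ cc).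
  apply/eq_waction_basis => x.
  by rewrite !waction_cat wactionK.
suff P c : {subset c <= [:: i; j]} -> B (word_basis ((s ++ rev cc) ++ c)) = 0.
  exact: P sub.
elim/last_ind: c => [_|c k IH csub]; first by rewrite cats0.
rewrite -rcons_cat; apply: Bstep; first by apply: csub; rewrite mem_rcons mem_head.
by apply: IH => z zc; apply: csub; rewrite mem_rcons inE zc orbT.
Qed.

End AbstractLevelZero.

(** * The principal series *)

Section HeckeAction.
Variables (C : fieldType) (I : choiceType) (ord : I -> I -> nat -> Prop) (q1 q2 : C).
Variables (V : lmodType C) (f : I -> {linear V -> V}).
Hypothesis f_quadratic : forall i v,
  f i (f i v) = (q1 + q2) *: f i v + (- (q1 * q2)) *: v.
Hypothesis f_braid : forall i j m v, ord i j m ->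
  word_act f (alt i j m) v = word_act f (alt j i m) v.
Local Notation H := (presented (hecke_rel ord q1 q2)).
Local Notation T := (hecke_T ord q1 q2).
Implicit Types (u : free_alg C I) (g : H) (v : V).

Lemma free_act_hecke_rel v u : hecke_rel ord q1 q2 u -> free_act f v u = 0.
Proof.
case=> {u} [i|i j m o]; last first.
  rewrite linearB /= !free_act_alternating.
  by apply/eqP; rewrite subr_eq0; apply/eqP; apply: f_braid.
have e q w : free_act f w (free_gen C i - q *: 1) = f i w - q *: w.
  rewrite linearB /= [free_act f w (q *: 1)]linearZ /=.
  by rewrite free_act1 free_act_gen.
rewrite free_actM !e [f i _]linearB [f i (q1 *: _)]linearZ /= f_quadratic.
rewrite scalerBr scalerA scalerDl scaleNr [q2 * q1]mulrC.
by rewrite [X in X - (_ - _)]addrAC [q1 *: _ + _]addrC addrK subrr.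
Qed.

Lemma free_act_ideal v u : u \in span_pred (ideal_gen (hecke_rel ord q1 q2)) ->
  free_act f v u = 0.
Proof.
move=> /span_predP; elim=> [|a x w [y [r [z [Rr ->]]]] _ IH]; first exact: linear0.
rewrite linearP /= IH addr0 !free_actM (free_act_hecke_rel _ Rr).
have := free_act_is_linear_l f z (-1) 0 0.
by rewrite scaler0 addr0 scaleN1r addNr => ->; rewrite scaler0.
Qed.

Definition hecke_act v g : V := free_act f v (repr g).

Lemma hecke_act_pi v u : hecke_act v (presented_pi _ u) = free_act f v u.
Proof.
apply/eqP; rewrite -subr_eq0 -linearB; apply/eqP/free_act_ideal.
by apply/span_piP; rewrite span_reprK.
Qed.

Lemma presented_piK g : presented_pi (hecke_rel ord q1 q2) (repr g) = g.
Proof. exact: span_reprK. Qed.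

Lemma hecke_act_is_linear v : linear (hecke_act v).
Proof.
move=> a g g'; rewrite -[g]presented_piK -[g']presented_piK -linearP.
by rewrite !hecke_act_pi linearP.
Qed.

HB.instance Definition _ v := GRing.isLinear.Build C H V *:%R (hecke_act v)
  (hecke_act_is_linear v).

Lemma hecke_act_is_linear_l g : linear (hecke_act ^~ g).
Proof. by move=> a v w; apply: free_act_is_linear_l. Qed.

Lemma hecke_actZl a v g : hecke_act (a *: v) g = a *: hecke_act v g.
Proof.
have z : hecke_act 0 g = 0.
  by have := hecke_act_is_linear_l g (-1) 0 0; rewrite scaler0 addr0 scaleN1r addNr.
by have := hecke_act_is_linear_l g a v 0; rewrite z !addr0.
Qed.

Lemma hecke_act1 v : hecke_act v 1 = v.
Proof. by rewrite -presented_pi1 hecke_act_pi free_act1. Qed.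

Lemma hecke_actM v g g' : hecke_act v (g * g') = hecke_act (hecke_act v g) g'.
Proof.
rewrite -[g]presented_piK -[g']presented_piK presented_piMr !hecke_act_pi.
exact: free_actM.
Qed.

Lemma hecke_actT v i : hecke_act v (T i) = f i v.
Proof. by rewrite hecke_act_pi free_act_gen. Qed.

End HeckeAction.

Lemma hecke_ind (C : fieldType) (I : choiceType) (ord : I -> I -> nat -> Prop)
    (q1 q2 : C) (P : presented (hecke_rel ord q1 q2) -> Prop) :
  P 1 -> (forall g i, P g -> P (g * hecke_T ord q1 q2 i)) ->
  (forall a g g', P g -> P g' -> P (a *: g + g')) -> forall g, P g.
Proof.
move=> P1 PT PD g; rewrite -[g]presented_piK; set u := repr g.
have P0 : P 0 by have := PD (-1) 1 1 P1 P1; rewrite scaleN1r addNr.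
have -> : u = \sum_(k <- msupp u) mcoeff k u *: (mkmalgU k 1 : free_alg C I).
  rewrite {1}[u]monalgE; apply: eq_bigr => k _.
  by apply/malgP => k'; rewrite mcoeffZ !mcoeffU mulr_natr mulrb; case: eqP.
rewrite linear_sum; elim/big_rec: _ => [//|m x _ Px]; rewrite linearZ /=.
apply: PD Px; case: m => s; elim/last_ind: s => [|s i IH].
  by rewrite -[X in P X]/(presented_pi _ (mkmalgU (FMonom [::]) 1)) -fmoneE.
have -> : mkmalgU (FMonom (rcons s i)) 1 =
    (mkmalgU (FMonom s) 1 : free_alg C I) * free_gen C i.
  rewrite malgM_def fgmulUU mulr1; congr mkmalgU.
  by apply/eqP; rewrite fmP fmM fmU cats1.
by rewrite -presented_piMr; apply: PT.
Qed.

Section Induced.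
Variables (C : fieldType) (I : choiceType) (ord : I -> I -> nat -> Prop) (q1 q2 : C).
Local Notation H := (presented (hecke_rel ord q1 q2)).
Variables (L : Type) (Y : L -> H) (chi : L -> C).
Local Notation M := (induced Y chi).
Implicit Types (x : M) (g : H).

Lemma induced_piP x : exists g, x = induced_pi Y chi g.
Proof. by exists (repr x); apply: esym; apply: span_reprK. Qed.

Lemma induced_pi_balance la g :
  induced_pi Y chi (Y la * g) = chi la *: induced_pi Y chi g.
Proof.
rewrite -linearZ; apply/span_piP; apply: span_gen.
by exists la, g.
Qed.

Definition induced_ract g x : M := induced_act x g.

Lemma induced_ract_pi g g' : induced_ract g (induced_pi Y chi g') = induced_pi Y chi (g' * g).
Proof. exact: induced_actE. Qed.

Lemma induced_ract_is_linear g : linear (induced_ract g).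
Proof.
move=> a x y; have [u ->] := induced_piP x; have [v ->] := induced_piP y.
by rewrite -linearP !induced_ract_pi -linearP mulrDl presented_scalerAl.
Qed.

HB.instance Definition _ g := GRing.isLinear.Build C M M *:%R (induced_ract g)
  (induced_ract_is_linear g).

Lemma induced_ractD a g g' x :
  induced_ract (a *: g + g') x = a *: induced_ract g x + induced_ract g' x.
Proof.
have [u ->] := induced_piP x.
by rewrite !induced_ract_pi -linearP mulrDr presented_scalerAr.
Qed.

Lemma induced_ractM g g' x : induced_ract (g * g') x = induced_ract g' (induced_ract g x).
Proof. by have [u ->] := induced_piP x; rewrite !induced_ract_pi mulrA. Qed.

Lemma induced_ract1 x : induced_ract 1 x = x.
Proof. by have [u ->] := induced_piP x; rewrite induced_ract_pi mulr1. Qed.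

Lemma induced_ract_Tinv i x : induced_ract (hecke_Tinv ord q1 q2 i) x =
  (q1 * q2)^-1 *: ((q1 + q2) *: x - induced_ract (hecke_T ord q1 q2 i) x).
Proof.
have [u ->] := induced_piP x; rewrite !induced_ract_pi /hecke_Tinv.
rewrite -presented_scalerAr mulrBr -presented_scalerAr mulr1.
move: (u * hecke_T ord q1 q2 i) => w.
have piZ a v : induced_pi Y chi (a *: v) = a *: induced_pi Y chi v by exact: linearZ.
have piB v v' : induced_pi Y chi (v - v') = induced_pi Y chi v - induced_pi Y chi v'.
  by exact: raddfB.
by rewrite piZ piB piZ.
Qed.

End Induced.

Section WeightStep.
Variables (C : fieldType) (V : lmodType C) (q1 q2 : C).
Hypotheses (q1_neq0 : q1 != 0) (q2_neq0 : q2 != 0).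

(** With the next lemma, the scalar part of the intertwining property: the weight
    [q2 ^ (- crossing)] absorbs the factor that a step produces on the level 0 side. *)
Lemma weight_step_pos (k : int) (z : V) : q2 *: (q2 ^ (- (k + 1)) *: z) = q2 ^ (- k) *: z.
Proof.
rewrite scalerA; congr (_ *: _).
by rewrite -{1}[q2]expr1z -expfzDr // opprD addrCA subrr addr0.
Qed.

Lemma weight_step_neg (k : int) (y z : V) :
  (q1 + q2) *: (q2 ^ (- k) *: y) -
    q1 *: (q2 ^ (- (k - 1)) *: ((q1 * q2)^-1 *: ((q1 + q2) *: y - z))) =
  q2 ^ (- k) *: z.
Proof.
have -> : q2 ^ (- (k - 1)) = q2 ^ (- k) * q2 by rewrite opprB addrC expfzDr // expr1z.
move: (q2 ^ (- k)) => w.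
have -> (v : V) : q1 *: ((w * q2) *: ((q1 * q2)^-1 *: v)) = w *: v.
  by rewrite !scalerA; congr (_ *: _); field; rewrite ?q1_neq0 ?q2_neq0.
rewrite scalerA [(q1 + q2) * _]mulrC -scalerA -scalerBr.
by rewrite opprB addrCA subrr addr0.
Qed.

End WeightStep.

(** Comes from [- q1 q2 = q q2^2]; it matches the normalisation of [Y] and the character with the
    [2 ht] crossed hyperplanes. *)
Lemma hecke_quadratic_scalar (C : fieldType) (q1 q2 : C) (k : int) :
  q1 != 0 -> q2 != 0 -> (- (q1 * q2)) ^ k * (- (q1 / q2)) ^ (- k) = q2 ^ (2 * k).
Proof.
move=> q1_neq0 q2_neq0.
have q_neq0 : - (q1 / q2) != 0 by rewrite oppr_eq0 mulf_neq0 // invr_eq0.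
have -> : - (q1 * q2) = - (q1 / q2) * q2 ^ 2.
  by rewrite mulNr -mulrA -[q2 ^ 2]/(q2 * q2) mulKf.
by rewrite expfzMl mulrAC -expfzDr // subrr expr0z mul1r exprz_exp.
Qed.

(** * The isomorphism with the principal series *)

Section AbstractPrincipalSeries.
Variables (R : realType) (n : nat) (A : affine_cartan R n).
Local Notation I := 'I_n.+1.
Local Notation h := 'rV[R]_n.+1.
Implicit Types (s u : seq I) (i j : I) (la : 'rV[int]_n).
Variables (theta : 'rV[int]_n) (thetaP : highest_coroot A theta).
Variables (c : h -> rat) (cP : reflection_spacing A c).
Hypothesis labelA : special_labelling A.
Local Notation r := (two_rho A).

Variables (C : fieldType) (q1 q2 : C) (q1_neq0 : q1 != 0) (q2_neq0 : q2 != 0).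
Local Notation ord := (coxeter_order A).
Local Notation H := (presented (hecke_rel ord q1 q2)).
Local Notation T := (hecke_T ord q1 q2).
Local Notation Tinv := (hecke_Tinv ord q1 q2).

Definition hecke_walk s : H :=
  signed_walk A ( *%R : Monoid.law (1 : H)) T Tinv r s.

Lemma hecke_walk_cat s s' : waction A (rev s) r = r ->
  hecke_walk (s ++ s') = hecke_walk s * hecke_walk s'.
Proof. by move=> e; rewrite /hecke_walk signed_walk_cat e. Qed.

Lemma hecke_walk_rcons s i : hecke_walk (rcons s i) =
  hecke_walk s * (if waction A (rev s) r 0 i < 0 then T i else Tinv i).
Proof. exact: signed_walk_rcons. Qed.

Lemma hecke_T_braid i j m : ord i j m ->
  \big[*%R/(1 : H)]_(k < m) T (nxt i j k) = \big[*%R/(1 : H)]_(k < m) T (nxt j i k).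
Proof.
move=> o; have := presented_rel (hecke_braid q1 q2 o).
rewrite linearB => /eqP; rewrite subr_eq0 => /eqP.
have piP k l : presented_pi (hecke_rel ord q1 q2) (alternating C k l m) =
    \big[*%R/(1 : H)]_(t < m) T (nxt k l t).
  by apply: (big_morph _ (fun x y => esym (presented_piMr _ x y))).
by rewrite !piP.
Qed.

Let TK i : T i * Tinv i = 1.
Proof. by case: (hecke_TK ord i q1_neq0 q2_neq0). Qed.

Let TVK i : Tinv i * T i = 1.
Proof. by case: (hecke_TK ord i q1_neq0 q2_neq0). Qed.

Let regular_r : regular_point A r.
Proof. exact: (regular_two_rho thetaP cP). Qed.

Lemma eq_hecke_walk s s' : waction A s =1 waction A s' -> hecke_walk s = hecke_walk s'.
Proof. by apply: (eq_signed_walk (op := *%R) TK TVK hecke_T_braid). Qed.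

Variables (Y : 'rV[int]_n -> H).
Hypothesis YE : forall la, exists2 z, waction A z =1 translation A c la &
  Y la = (- (q1 * q2)) ^ (- height la) *: hecke_walk z.
Let chi la := (- (q1 / q2)) ^ (- height la).
Local Notation M := (induced Y chi).
Local Notation pi := (induced_pi Y chi).

Let fixr la z : waction A z =1 translation A c la -> waction A (rev z) r = r.
Proof.
by move=> /translation_walkN ->; rewrite translation_fixed // (two_rho_h0 thetaP).
Qed.

Let q12_neq0 : - (q1 * q2) != 0.
Proof. by rewrite oppr_eq0 mulf_neq0. Qed.

Let hecke_walk_translation la z : waction A z =1 translation A c la ->
  hecke_walk z = (- (q1 * q2)) ^ height la *: Y la.
Proof.
move=> e; have [z' e' ->] := YE la.
rewrite scalerA -expfzDr ?q12_neq0 // subrr expr0z scale1r; apply: eq_hecke_walk => x.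
by rewrite e e'.
Qed.

Definition walk_weight s : C := q2 ^ (- crossing A r s).

(** Two words with the same finite image differ by a translation on the left. Its walk is a multiple
    of some [Y la], which the balancing relations replace by a scalar, and the weight compensates
    exactly for that scalar. *)
Lemma induced_walk_eq s s' : cl A s = cl A s' ->
  walk_weight s *: pi (hecke_walk s) = walk_weight s' *: pi (hecke_walk s').
Proof.
move=> e; have [la laE] := cl_eq cP labelA e.
have [z ez _] := YE la.
have es : waction A s =1 waction A (z ++ s') by move=> x; rewrite laE waction_cat ez.
rewrite (eq_hecke_walk es) /walk_weight (eq_crossing regular_r es).
rewrite crossing_cat (fixr ez) (crossing_translation thetaP cP ez).
rewrite (hecke_walk_cat _ (fixr ez)).
rewrite (hecke_walk_translation ez) -presented_scalerAl linearZ /= induced_pi_balance.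
rewrite !scalerA; congr (_ *: _); rewrite -mulrA /chi hecke_quadratic_scalar //.
by rewrite -expfzDr // opprD; congr (_ ^ _); lia.
Qed.

Variables (V : lmodType C) (word_basis : seq I -> V) (f : I -> {linear V -> V}).
Hypothesis eq_word_basis : forall s s', cl A s = cl A s' ->
  word_basis s = word_basis s'.
Hypothesis word_basis_ext : forall (N : lmodType C) (G : seq I -> N),
  (forall s s', cl A s = cl A s' -> G s = G s') ->
  exists g : {linear V -> N}, forall s, g (word_basis s) = G s.
Hypothesis word_basis_linear_eq : forall (N : lmodType C) (g g' : {linear V -> N}),
  (forall s, g (word_basis s) = g' (word_basis s)) -> g =1 g'.
Hypothesis level0_T_basis : forall s i, f i (word_basis s) =
  if 0 < waction A (rev s) r 0 i then q2 *: word_basis (rcons s i)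
  else (q1 + q2) *: word_basis s - q1 *: word_basis (rcons s i).

Let eq_waction_basis s s' : waction A s =1 waction A s' -> word_basis s = word_basis s'.
Proof. by move=> e; apply/eq_word_basis/eq_waction_cl. Qed.

Let f_quadratic := level0_T_quadratic regular_r eq_waction_basis
  (@word_basis_linear_eq V) level0_T_basis.

Let f_braid := level0_braid regular_r q1_neq0 q2_neq0 eq_waction_basis
  (@word_basis_linear_eq V) level0_T_basis.

Variables (s0 : seq I) (s0P : forall j : 'I_n, waction A (rev s0) r 0 (fnode j) < 0).

(** On level 0 points a real root counts through its finite part, and every positive finite root is
    positive at [r] but negative at [s0^-1 r]. *)
Let sign_s0 s i :
  (0 < waction A (rev (s0 ++ s)) r 0 i) = (waction A (rev s) r 0 i < 0).
Proof.
rewrite rev_cat waction_cat !waction_rev_coord.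
have [a [av [k [t [fa t0 ->]]]]] := real_root_hyperplane cP s i.
rewrite !pairingZr !pairingBr !pairingZr waction_delta (two_rho_h0 thetaP).
rewrite mulr0 !subr0 pmulr_llt0; last exact: (pos_froot_two_rho thetaP fa).
by rewrite nmulr_lgt0 //; apply: pos_froot_pairing_lt0 fa.
Qed.

Local Notation act := (hecke_act (ord := ord) (q1 := q1) (q2 := q2) f).

Let actM := hecke_actM f_quadratic f_braid.
Let actT := hecke_actT f_quadratic f_braid.
Let act1 := hecke_act1 f_quadratic f_braid.

Lemma hecke_act_lin v (a : C) (g g' : H) : act v (a *: g + g') = a *: act v g + act v g'.
Proof. exact: hecke_act_is_linear. Qed.

Lemma hecke_act0 v : act v (0 : H) = 0.
Proof. by have := hecke_act_lin v (-1) 0 0; rewrite scaler0 addr0 scaleN1r addNr. Qed.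

Lemma hecke_actZ v (a : C) (g : H) : act v (a *: g) = a *: act v g.
Proof. by have := hecke_act_lin v a g 0; rewrite hecke_act0 !addr0. Qed.

Lemma hecke_actB v (g g' : H) : act v (g - g') = act v g - act v g'.
Proof. by have := hecke_act_lin v (-1) g' g; rewrite !scaleN1r ![- _ + _]addrC. Qed.

Lemma hecke_actTinv v i :
  act v (Tinv i) = (q1 * q2)^-1 *: ((q1 + q2) *: v - f i v).
Proof.
by rewrite /hecke_Tinv hecke_actZ hecke_actB actT hecke_actZ act1.
Qed.

Let b0 := word_basis s0.

Lemma hecke_act_walk s :
  act b0 (hecke_walk s) = q2 ^ crossing A r s *: word_basis (s0 ++ s).
Proof.
elim/last_ind: s => [|s i IH].
  by rewrite /hecke_walk /crossing /= cats0 expr0z scale1r act1.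
rewrite hecke_walk_rcons crossing_rcons expfzDr //.
rewrite actM IH hecke_actZl -rcons_cat -scalerA; congr (_ *: _).
have := level0_T_basis (s0 ++ s) i; rewrite sign_s0; case: ifP => _ e.
  by rewrite actT e expr1z.
rewrite hecke_actTinv e opprB addrCA subrr addr0 scalerA; congr (_ *: _).
by rewrite invfM -mulrA mulrC mulfK // ; case: (q2^-1).
Qed.

Lemma hecke_actY la : act b0 (Y la) = chi la *: b0.
Proof.
have [z ez ->] := YE la; rewrite hecke_actZ hecke_act_walk.
rewrite (crossing_translation thetaP cP ez) scalerA.
have -> : word_basis (s0 ++ z) = b0.
  apply: eq_word_basis; rewrite cl_cat.
  have -> : cl A z = cl A [::].
    by apply: eq_cl => x x0; rewrite ez translation_fixed.
  by rewrite -cl_cat cats0.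
congr (_ *: _); rewrite -(hecke_quadratic_scalar (height la) q1_neq0 q2_neq0) mulrA.
by rewrite -expfzDr ?q12_neq0 // addNr expr0z mul1r.
Qed.

Definition induced_hom (x : M) : V := act b0 (repr x).

Lemma induced_hom_pi g : induced_hom (pi g) = act b0 g.
Proof.
apply/eqP; rewrite -subr_eq0; apply/eqP.
rewrite /induced_hom -hecke_actB.
have: repr (pi g) - g \in span_pred (balancing Y chi).
  by apply/span_piP; rewrite span_reprK.
move/span_predP; elim=> [|a u w [la [g' ->]] _ IH]; first exact: hecke_act0.
rewrite hecke_act_lin IH addr0 hecke_actB actM hecke_actY.
by rewrite hecke_actZ hecke_actZl // subrr scaler0.
Qed.

Lemma induced_hom_is_linear : linear induced_hom.
Proof.
move=> a x y; have [u ->] := induced_piP x; have [v ->] := induced_piP y.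
by rewrite -linearP !induced_hom_pi hecke_act_lin.
Qed.

HB.instance Definition _ := GRing.isLinear.Build C M V *:%R induced_hom
  induced_hom_is_linear.

Lemma principal_series_iso : exists phi : {linear V -> M},
  bijective phi /\ forall i v, phi (f i v) = induced_act (phi v) (T i).
Proof.
(* Walks start at [s0], so the basis vector of [s] is reached by the word [s0^-1 s]. *)
have [s s' e|phi phiE] := @word_basis_ext M (fun s =>
  walk_weight (rev s0 ++ s) *: pi (hecke_walk (rev s0 ++ s))).
  by apply: induced_walk_eq; rewrite !cl_cat e.
have phi_s0 s : phi (word_basis (s0 ++ s)) = walk_weight s *: pi (hecke_walk s).
  rewrite phiE; apply: induced_walk_eq; apply: eq_waction_cl => x.
  by rewrite !waction_cat wactionK.
have basis_s0 s : word_basis s = word_basis (s0 ++ (rev s0 ++ s)).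
  by apply: eq_waction_basis => x; rewrite !waction_cat wactionVK.
have phiZ a v : phi (a *: v) = a *: phi v by exact: linearZ.
have phiB v w : phi (v - w) = phi v - phi w by exact: raddfB.
have ractZ g a (x : M) : induced_ract g (a *: x) = a *: induced_ract g x by exact: linearZ.
have phiT i v : phi (f i v) = induced_ract (T i) (phi v).
  pose g : {linear V -> M} := (phi \o f i)%FUN.
  pose g' : {linear V -> M} := (induced_ract (T i) \o phi)%FUN.
  apply: (word_basis_linear_eq (g := g) (g' := g')) => s; rewrite /g /g' /=.
  rewrite basis_s0; move: (rev s0 ++ s) => {}s.
  have e := phi_s0 (rcons s i); rewrite -rcons_cat in e.
  rewrite phi_s0 ractZ level0_T_basis sign_s0.
  rewrite /walk_weight crossing_rcons hecke_walk_rcons in e.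
  rewrite -induced_ract_pi in e; case: (_ < 0) e => e.
    by rewrite phiZ e; apply: weight_step_pos.
  rewrite phiB !phiZ phi_s0 e induced_ract_Tinv.
  exact: weight_step_neg.
have phi1 : phi b0 = pi 1.
  have := phi_s0 [::]; rewrite cats0 -/b0 => ->.
  by rewrite /walk_weight /crossing /hecke_walk /= oppr0 expr0z scale1r.
exists phi; split; last exact: phiT.
exists induced_hom => [v|x].
  pose g : {linear V -> V} := (induced_hom \o phi)%FUN.
  apply: (word_basis_linear_eq (g := g) (g' := idfun)) => s; rewrite /g /=.
  rewrite basis_s0 phi_s0 linearZ /= induced_hom_pi hecke_act_walk scalerA.
  by rewrite -expfzDr // addNr expr0z scale1r.
have [g ->] := induced_piP x; rewrite induced_hom_pi.
(* Commutation with the generators extends to all of [H]; applied to [b0], whose image generates the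
   induced module, it gives the second composite. *)
have H v : phi (act v g) = induced_ract g (phi v).
  elim/hecke_ind: g v => [|g i IH|a g g' IH IH'] v.
  - by rewrite act1 induced_ract1.
  - by rewrite actM actT phiT IH induced_ractM.
  - by rewrite hecke_act_lin linearP IH IH' induced_ractD.
by rewrite H phi1 induced_ract_pi mul1r.
Qed.

End AbstractPrincipalSeries.

(** * Specialisation to the concrete modules *)

Section PrincipalSeries.
Variables (R : realType) (n : nat) (A : affine_cartan R n).
Local Notation I := 'I_n.+1.
Local Notation h := 'rV[R]_n.+1.
Implicit Types (s u : seq I) (i j : I) (la : 'rV[int]_n).
Variables (theta : 'rV[int]_n) (thetaP : highest_coroot A theta).
Variables (c : h -> rat) (cP : reflection_spacing A c).
Variables (l : R) (l_gt0 : 0 < l) (q1 q2 : R[i]).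

Lemma word_basis_ext (N : lmodType R[i]) (G : seq I -> N) :
  (forall s s', cl A s = cl A s' -> G s = G s') ->
  exists g : {linear CW0 A -> N}, forall s, g (word_basis A s) = G s.
Proof.
move=> GE; have [f fE] := boolp.choice (@W0_of_wordP R n A).
exists (malg_ext (fun w => G (f w)) : {linear malg (W0 A) R[i] -> N}) => s.
transitivity (1 *: G (f (W0_of_word A s))); first exact: malg_extU.
by rewrite scale1r; apply: GE; have /(congr1 val) := fE (W0_of_word A s).
Qed.

(** The prefix already walked enters only through the viewpoint [pre^-1 rho]. *)
Lemma walk_TE pre s : walk_T A c l q1 q2 pre s =
  signed_walk A *%R (hecke_T (coxeter_order A) q1 q2)
    (hecke_Tinv (coxeter_order A) q1 q2) (waction A (rev pre) (two_rho A)) s.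
Proof.
elim: s pre => [|i s IH] pre //; rewrite [LHS]/= IH rev_rcons [RHS]/=.
have P := positive_stepP thetaP cP l_gt0 pre i.
by case: asboolP => [/P -> //|nP]; case: ifP => // /P.
Qed.

Lemma YE la : exists2 z, waction A z =1 translation A c la &
  Y A c l q1 q2 la = (- (q1 * q2)) ^ (- height la) *: hecke_walk A q1 q2 z.
Proof.
exists (xget [::] (translation_walk A c la)); last by rewrite /Y walk_TE.
(* The default value of [xget] is never returned, since every translation lies in [W]. *)
by apply: (@xgetPex _ [::] (translation_walk A c la)); apply: translation_walk_exists cP la.
Qed.

End PrincipalSeries.

Theorem theorem7p1 (R : realType) (n : nat) (n_gt0 : (0 < n)%N)
    (A : affine_cartan R n) (labelA : special_labelling A)
    (c : 'rV[R]_n.+1 -> rat) (cP : reflection_spacing A c)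
    (l : R) (l_gt0 : 0 < l)
    (theta : 'rV[int]_n) (thetaP : highest_coroot A theta)
    (q1 q2 : R[i]) (q1_neq0 : q1 != 0) (q2_neq0 : q2 != 0) :
  let q := - (q1 / q2) in
  (forall k : nat, (0 < k)%N -> k%:Z <= 2 * height theta -> ~~ k.-unity_root q) ->
  let t (la : 'rV[int]_n) := q ^ (- height la) in
  exists phi : {linear CW0 A -> principal_series A c l q1 q2 t},
    bijective phi /\
    forall (i : 'I_n.+1) (v : CW0 A),
      phi (level0_T q1 q2 i v) = principal_series_T i (phi v).
Proof.
move=> q _ t; have [s0 s0P] := antidominant_two_rho thetaP.
(* The base element is the inverse of the word found: it is [w^-1 rho] that has to be
   antidominant. *)
have s0P' j : waction A (rev (rev (map (@fnode n) s0))) (two_rho A) 0 (fnode j) < 0.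
  by rewrite revK.
exact: (principal_series_iso thetaP cP labelA q1_neq0 q2_neq0
  (YE thetaP cP l_gt0 q1 q2) (@eq_word_basis R n A) (@word_basis_ext R n A)
  (@word_basis_linear_eq R n A) (@level0_T_basis R n A theta thetaP q1 q2) s0P').
Qed.
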